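(* Let $X,Y\subset\Omega$ be two disjoint convex compact domains in $\mathbb{R}^3$. Assume that $X$ and $Y$ have disjoint projections onto the $xy$-plane and disjoint projections onto the $z$-axis. Let $\alpha$, $1\le\alpha\le2$, be a constant such that the correlation function satisfies $|\mathcal{C}(\mathbf{y}_1,\mathbf{y}_2)|\le O\big((n|\mathbf{y}_1-\mathbf{y}_2|)^{-\alpha}\big)$ when $n|\mathbf{y}_1-\mathbf{y}_2|\to\infty$, $\mathbf{y}_1,\mathbf{y}_2\in Y$. For any $\varepsilon>0$, if there are functions $f_l\in L^2(X)$ and $g_l\in L^2(Y)$, $l=1,\dots,N^{\varepsilon}$, such that $$\Big\|G_{n0}(\mathbf{x},\mathbf{y})-\sum_{l=1}^{N^{\varepsilon}}f_l(\mathbf{x})\,g_l(\mathbf{y})\Big\|_{L^2(X\times Y)}\le\varepsilon\,\|G_{n0}\|_{L^2(X\times Y)},$$ then, as $n\to\infty$, $$N^{\varepsilon}\ge\begin{cases}O(n^{3-3\delta}),&\text{if }\tfrac32\le\alpha\le2,\\ O(n^{2\alpha}),&\text{if }1\le\alpha<\tfrac32,\end{cases}$$ where $\delta\in(0,1)$ is an arbitrary number.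
   Context: $\Omega\subset\mathbb{R}^3$ is a bounded convex domain. The coefficient $\sigma_t$ is a real-valued function, smooth over $\Omega$, with $0<\sigma_0\le\sigma_t\le\sigma_1<\infty$ for some constants $\sigma_0,\sigma_1$. For $\mathbf{x}\ne\mathbf{y}$ in $\Omega$ set $$E(\mathbf{x},\mathbf{y})=\exp\Big(-|\mathbf{x}-\mathbf{y}|\int_0^1\sigma_t(\mathbf{x}+(\mathbf{y}-\mathbf{x})s)\,ds\Big),\qquad G_{n0}(\mathbf{x},\mathbf{y})=\frac{E(\mathbf{x},\mathbf{y})}{|\mathbf{x}-\mathbf{y}|^2}\,Y_{n0}\Big(\frac{\mathbf{x}-\mathbf{y}}{|\mathbf{x}-\mathbf{y}|}\Big),$$ where $Y_{n0}(\theta,\phi)=\sqrt{\tfrac{2n+1}{4\pi}}\,P_n(\cos\theta)$, $\theta$ is the polar angle measured from the $z$-axis, $\phi$ the azimuthal angle, and $P_n$ is the Legendre polynomial of degree $n$. The correlation function is $$\mathcal{C}(\mathbf{y}_1,\mathbf{y}_2)=\frac{1}{\|G_{n0}(\cdot,\mathbf{y}_1)\|_2\,\|G_{n0}(\cdot,\mathbf{y}_2)\|_2}\int_X G_{n0}(\mathbf{x},\mathbf{y}_1)\,\overline{G_{n0}(\mathbf{x},\mathbf{y}_2)}\,d\mathbf{x},\qquad \|\cdot\|_2=\|\cdot\|_{L^2(X)}.$$ The decay condition on $\mathcal{C}$ means: there are constants $C,R>0$ such that $|\mathcal{C}(\mathbf{y}_1,\mathbf{y}_2)|\le C(n|\mathbf{y}_1-\mathbf{y}_2|)^{-\alpha}$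 for all $n$ and $\mathbf{y}_1,\mathbf{y}_2\in Y$ with $n|\mathbf{y}_1-\mathbf{y}_2|\ge R$. The functions $f_l,g_l$ and the number $N^{\varepsilon}$ may depend on $n$. ''$N^{\varepsilon}\ge O(h(n))$ as $n\to\infty$'' means that $N^{\varepsilon}\ge c\,h(n)$ for all sufficiently large $n$, with a constant $c>0$ independent of $n$ and of the choice of $f_l,g_l$.
   Formalization: The accuracy ε is restricted to 0<ε<1: for ε≥1 the claim fails, since N=1 with f_1=g_1=0 satisfies the approximation inequality for every n, so no lower bound growing with n can hold. *)

(* Defs.v *)
From HB Require Import structures.
From mathcomp Require Export all_boot all_order all_algebra.
From mathcomp Require Export all_classical all_reals all_analysis.
From mathcomp Require Export complex.
Export Order.TTheory GRing.Theory Num.Theory.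
Export numFieldNormedType.Exports.

Set Implicit Arguments.
Unset Strict Implicit.
Unset Printing Implicit Defensive.

Local Open Scope classical_set_scope.
Local Open Scope ring_scope.

(* R^3 as iterated pairs, so that its topology, its sigma-algebra and its
   Lebesgue measure are the product ones.  The library norm `|x| on this type
   is the sup norm; the Euclidean norm is [enorm]. *)
Notation R3 R := ((measurableTypeR R * measurableTypeR R) * measurableTypeR R)%type.

Lemma product_measure1_sigma_finite d1 d2 (T1 : measurableType d1)
    (T2 : measurableType d2) (R : realType)
    (m1 : {sigma_finite_measure set T1 -> \bar R})
    (m2 : {sigma_finite_measure set T2 -> \bar R}) :
  sigma_finite [set: T1 * T2] (m1 \x m2)%E.
Proof.
have /sigma_finiteP[F [TF ndF Foo]] := sigma_finiteT m1.
have /sigma_finiteP[G [TG ndG Goo]] := sigma_finiteT m2.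
exists (fun n => F n `*` G n).
  rewrite -setXTT TF TG predeqE => -[x y]; split.
    move=> [/= [n _ Fnx] [k _ Gky]]; exists (maxn n k) => //; split.
    - by move: x Fnx; exact/subsetPset/ndF/leq_maxl.
    - by move: y Gky; exact/subsetPset/ndG/leq_maxr.
  by move=> [n _ []/= ? ?]; split; exists n.
move=> k; have [? ?] := Foo k; have [? ?] := Goo k.
split; first exact: measurableX.
by rewrite product_measure1E// lte_mul_pinfty// ge0_fin_numE.
Qed.

Section Space.
Context {R : realType}.
Implicit Types x u : R3 R.

Definition xcoord x : R := x.1.1.
Definition ycoord x : R := x.1.2.
Definition zcoord x : R := x.2.

Definition xyproj x : R * R := (xcoord x, ycoord x).

Definition enorm x : R :=
  Num.sqrt (xcoord x ^+ 2 + ycoord x ^+ 2 + zcoord x ^+ 2).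

Definition lebesgue2 : set (measurableTypeR R * measurableTypeR R) -> \bar R :=
  (@lebesgue_measure R \x @lebesgue_measure R)%E.
HB.instance Definition _ := Measure.on lebesgue2.
HB.instance Definition _ := Measure_isSigmaFinite.Build _ _ _ lebesgue2
  (product_measure1_sigma_finite _ _).

Definition lebesgue3 : set (R3 R) -> \bar R :=
  (lebesgue2 \x @lebesgue_measure R)%E.
HB.instance Definition _ := Measure.on lebesgue3.
HB.instance Definition _ := Measure_isSigmaFinite.Build _ _ _ lebesgue3
  (product_measure1_sigma_finite _ _).

Definition basis3 (i : 'I_3) : R3 R :=
  (((i == 0 :> nat)%:R, (i == 1 :> nat)%:R), (i == 2 :> nat)%:R).

Definition iter_partial (s : seq 'I_3) (f : R3 R -> R) : R3 R -> R :=
  foldr (fun i g => 'D_(basis3 i) g) f s.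

(* Meant for an open set D: all partial derivatives of all orders exist and are
   continuous on D. *)
Definition smooth_on (D : set (R3 R)) (f : R3 R -> R) : Prop :=
  forall (s : seq 'I_3) x, D x ->
    {for x, continuous (iter_partial s f)} /\
    forall i, derivable (iter_partial s f) x (basis3 i).

Definition bounded_convex_domain (D : set (R3 R)) : Prop :=
  [/\ open D, D !=set0, bounded_set D & convex_set D].

(* A compact domain has interior points (it is the closure of an open set). *)
Definition convex_compact_domain (D : set (R3 R)) : Prop :=
  [/\ compact D, D^° !=set0 & convex_set D].

End Space.

Section L2.
Local Open Scope ereal_scope.
Context d (T : measurableType d) (R : realType).
Variable mu : {measure set T -> \bar R}.

Definition L2norm (D : set T) (f : T -> R) : \bar R :=
  'N[mu]_(2%:E)[(EFin \o f) \_ D].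

Definition cL2norm (D : set T) (f : T -> R[i]) : \bar R :=
  L2norm D (fun x => Normc.normc (f x)).

Definition in_cL2 (D : set T) (f : T -> R[i]) : Prop :=
  [/\ measurable_fun D (fun x => complex.Re (f x)),
      measurable_fun D (fun x => complex.Im (f x)) &
      cL2norm D f < +oo].

End L2.

Section Kernel.
Context {R : realType}.
Implicit Types x y u : R3 R.

(* Rodrigues' formula *)
Definition legendre (n : nat) : {poly R} :=
  (2 ^+ n * n`!%:R)^-1 *: (('X^2 - 1) ^+ n)^`(n).

Definition polar_angle u : R := acos (zcoord u).

(* the zonal harmonic Y_{n0}; it does not depend on the azimuthal angle *)
Definition Yn0 (n : nat) (theta : R) : R :=
  Num.sqrt ((2 * n + 1)%:R / (4 * pi)) * (legendre n).[cos theta].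

Definition attenuation (sigma : R3 R -> R) x y : R :=
  expR (- enorm (x - y) *
    \int[@lebesgue_measure R]_(s in `[0, 1]) sigma (x + s *: (y - x)))%R.

(* G_{n0} is real, so the complex conjugate in the correlation is dropped. *)
Definition Gn0 (sigma : R3 R -> R) (n : nat) x y : R :=
  attenuation sigma x y / enorm (x - y) ^+ 2 *
  Yn0 n (polar_angle ((enorm (x - y))^-1 *: (x - y))).

Definition correlation (sigma : R3 R -> R) (X : set (R3 R)) (n : nat) y1 y2 : R :=
  (fine (L2norm lebesgue3 X (Gn0 sigma n ^~ y1)) *
   fine (L2norm lebesgue3 X (Gn0 sigma n ^~ y2)))^-1 *
  (\int[lebesgue3]_(x in X) (Gn0 sigma n x y1 * Gn0 sigma n x y2))%R.

Definition correlation_decay (sigma : R3 R -> R) (X Y : set (R3 R)) (alpha : R) : Prop :=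
  exists C r : R, [/\ 0 < C, 0 < r &
    forall (n : nat) y1 y2, Y y1 -> Y y2 -> r <= n%:R * enorm (y1 - y2) ->
      `|correlation sigma X n y1 y2| <= C * (n%:R * enorm (y1 - y2)) `^ (- alpha)].

(* ||G_{n0} - sum_l f_l g_l|| <= eps ||G_{n0}|| in L^2(X * Y) *)
Definition separable_approx (sigma : R3 R -> R) (X Y : set (R3 R)) (n : nat) (eps : R)
    (N : nat) (f g : 'I_N -> R3 R -> R[i]) : Prop :=
  (cL2norm (lebesgue3 \x lebesgue3) (X `*` Y)
     (fun z => (Gn0 sigma n z.1 z.2)%:C%C - (\sum_(l < N) f l z.1 * g l z.2)%R)%R
   <= eps%:E * L2norm (lebesgue3 \x lebesgue3) (X `*` Y)
        (fun z => Gn0 sigma n z.1 z.2))%E.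

Definition rank_rate (alpha delta : R) (n : nat) : R :=
  if 3 / 2 <= alpha then n%:R `^ (3 - 3 * delta) else n%:R `^ (2 * alpha).

End Kernel.

(* Main.v *)
Require Import Defs.
From mathcomp Require Import ring lra measurable_realfun.
From mathcomp Require polyrcf.

(** Write H for the Gram kernel H(y, y') = int_X G(x, y) G(x, y') dx, where G is
the kernel G_{n0}, and T for the squared norm of G on X * Y, that is, the
trace of H.  A kernel with M real separable terms captures at most the M
largest eigenvalues of H, whose sum is at most sqrt M times the
Hilbert-Schmidt norm of H; an approximation of relative accuracy eps
therefore needs M >= (1 - eps^2)^2 T^2 / ||H||^2.  This is
[finite_rank_bound]; its proof avoids the spectral theorem and uses an
orthogonal system spanning the second factors, projections at every fixed x,
and Bessel's inequality for the rows of H.  Complex factors are reduced to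
real ones by taking real parts, which doubles the number of terms.

It remains to bound T from below and ||H|| from above, both in terms of one
scale depending on n, which then cancels.  The projections of X and Y onto
the xy-plane are disjoint compact sets, so the directions x - y stay away
from the z-axis.  There, Legendre's equation shows that the Sonin energy
(1 - t^2) P_n'^2 + n (n + 1) P_n^2 is constant up to bounded factors: it is
nondecreasing in |t| and its product with 1 - t^2 is nonincreasing.  Hence G^2 is
at most a constant times that scale ([Gn0_sqr_le]).  On average half of the
energy is carried by P_n^2, since the difference of the two halves is the
derivative of (1 - t^2) P_n P_n', which is smaller by a factor n;
integrating over vertical segments in Y gives a lower bound of the same
order for T ([legendre_line_mass], [section_mass_ge]).

Finally |H(y, y')| is the product of two column norms and of the correlation,
so H^2 is at most the square of the scale times a constant times
(n |y - y'|)^(- gamma) for every 0 < gamma <= 2 alpha: near the diagonal the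
trivial bound on the correlation suffices.  When moreover gamma < 3, the
function |v|^(- gamma) is integrable near 0 and ||H||^2 is O(n^(- gamma))
relative to the squared scale ([gram_row_le]).  The choices
gamma = 3 - 3 delta for alpha >= 3/2 and gamma = 2 alpha for alpha < 3/2 give
the two rates. *)

Set Implicit Arguments.
Unset Strict Implicit.
Unset Printing Implicit Defensive.

Local Open Scope classical_set_scope.
Local Open Scope ring_scope.

(** * Legendre polynomials and their Sonin energy *)

Section LegendrePolynomials.
Context {R : realType}.
Implicit Types (n : nat) (t : R).

(** Differentiating (X^2 - 1) u' = 2 n X u repeatedly preserves the shape of the
equation; the case k = n is Legendre's equation. *)
Lemma rodrigues_derivn_ode n k (u := ('X^2 - 1 : {poly R}) ^+ n) :
  ('X^2 - 1) * u^`(k.+2) + (2 * (k.+1%:R - n%:R)) *: ('X * u^`(k.+1)) +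
    (k.+1%:R * (k%:R - 2 * n%:R)) *: u^`(k) = 0.
Proof.
have natC m : (m%:R : R)%:P = m%:R by rewrite rmorph_nat.
have dx2 : ('X^2 - 1 : {poly R})^`() = 2%:R * 'X.
  by rewrite !poly.derivE subr0 expr1 mulr_natl.
have u1 : ('X^2 - 1) * u^`() = (2 * n%:R) *: ('X * u).
  rewrite {}/u -mul_polyC rmorphM /= !natC; case: n => [|n].
    by rewrite expr0 poly.derivE !mulr0 mul0r.
  by rewrite deriv_exp dx2 /= (exprS ('X^2 - 1)) -mulr_natr; ring.
elim: k => [|k IH].
  have := congr1 deriv u1; rewrite derivM dx2 derivZ derivM derivX mul1r.
  rewrite !derivnS !derivn0 -!mul_polyC !(rmorphM, rmorphB) /= !natC => h.
  apply/eqP; move/eqP: h; rewrite -subr_eq0 => /eqP h; apply/eqP; rewrite -[RHS]h.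
  by ring.
have := congr1 deriv IH; rewrite !derivD derivM dx2 !derivZ derivM derivX mul1r deriv0.
rewrite -!derivnS -!mul_polyC !(rmorphM, rmorphB) /= !natC => h.
by rewrite -[RHS]h -!natr1; ring.
Qed.

Definition legendre_eigenvalue n : R := n%:R * n.+1%:R.

Lemma legendre_ode n t :
  (1 - t ^+ 2) * (legendre n)^`()^`().[t] - 2 * t * (legendre n)^`().[t] +
    legendre_eigenvalue n * (legendre n).[t] = 0.
Proof.
have /(congr1 (horner^~ t)) := rodrigues_derivn_ode n n; rewrite !hornerE /= => h.
rewrite /legendre_eigenvalue /legendre !derivZ -!derivnS !hornerE /=.
move: h; set c := (_ * _)^-1; set u2 := _.[t]; set u1 := _.[t]; set u0 := _.[t].
by rewrite -natr1 => h; rewrite -(mulr0 (- c)) -h -natr1; ring.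
Qed.

Lemma legendre_neq0 n : legendre n != 0 :> {poly R}.
Proof.
rewrite /legendre scaler_eq0 negb_or invr_eq0 mulf_eq0 negb_or.
rewrite expf_eq0 pnatr_eq0 andbF pnatr_eq0 -lt0n fact_gt0 /=.
apply/negP => /eqP /(congr1 (fun p : {poly R} => p`_n)) /eqP.
have monic_u : ('X^2 - 1 : {poly R}) ^+ n \is monic.
  by apply: monic_exp; rewrite monicXnsubC.
have size_u : (size (('X^2 - 1 : {poly R}) ^+ n)).-1 = (n + n)%N.
  by rewrite size_exp size_XnsubC// mul2n addnn.
rewrite coef_derivn coef0; move/monicP: monic_u; rewrite lead_coefE size_u => ->.
by apply/negP; rewrite pnatr_eq0 -lt0n ffact_gt0 leq_addr.
Qed.

(** The Sonin energy of Legendre's equation.  Comparing it with its value at 0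
replaces the asymptotic expansion of P_n for large n. *)
Definition sonin n : {poly R} :=
  (1 - 'X^2) * (legendre n)^`() ^+ 2 + legendre_eigenvalue n *: (legendre n) ^+ 2.

Lemma sonin_deriv n t : (sonin n)^`().[t] = 2 * t * (legendre n)^`().[t] ^+ 2.
Proof.
have ode := legendre_ode n t.
have dx2 : (1 - 'X^2 : {poly R})^`() = - (2 *: 'X).
  by rewrite !poly.derivE sub0r expr1 scaler_nat.
rewrite /sonin; move: (legendre n) ode => p ode.
rewrite derivD derivM derivZ dx2 ![p^`() ^+ 2]expr2 ![p ^+ 2]expr2 !derivM !hornerE /=.
rewrite -[RHS]addr0 -[X in _ = _ + X](mulr0 (2 * p^`().[t])) -ode; ring.
Qed.

Lemma weighted_sonin_deriv n t :
  ((1 - 'X^2) * sonin n)^`().[t] = - (2 * t * legendre_eigenvalue n * (legendre n).[t] ^+ 2).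
Proof.
have dx2 : (1 - 'X^2 : {poly R})^`() = - (2 *: 'X).
  by rewrite !poly.derivE sub0r expr1 scaler_nat.
rewrite derivM hornerD !hornerM sonin_deriv dx2 /sonin.
by move: (legendre n) => p; rewrite !hornerE /= /legendre_eigenvalue; ring.
Qed.

Lemma sonin_hornerE n t : (sonin n).[t] =
  (1 - t ^+ 2) * (legendre n)^`().[t] ^+ 2 + legendre_eigenvalue n * (legendre n).[t] ^+ 2.
Proof. by rewrite /sonin !hornerE. Qed.

(** The derivative 2 t P_n'(t)^2 of the energy has the sign of t. *)
Lemma sonin_ge n t : (sonin n).[0] <= (sonin n).[t].
Proof.
have [t0|t0|->//] := ltrgtP t 0.
- have [c ct] := polyrcf.poly_mvt (sonin n) t0; rewrite sonin_deriv => h.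
  have /andP[_ c0] : t < c < 0 by move: ct; rewrite in_itv.
  have := sqr_ge0 ((legendre n)^`().[c]); move: h; set q := _ ^+ 2 => h q0.
  have : 0 <= (- c) * (- t) * q by rewrite mulr_ge0// mulr_ge0// oppr_ge0 ltW.
  by move: h; lra.
- have [c ct] := polyrcf.poly_mvt (sonin n) t0; rewrite sonin_deriv => h.
  have /andP[c0 _] : 0 < c < t by move: ct; rewrite in_itv.
  have := sqr_ge0 ((legendre n)^`().[c]); move: h; set q := _ ^+ 2 => h q0.
  have : 0 <= c * t * q by rewrite mulr_ge0// mulr_ge0// ltW.
  by move: h; lra.
Qed.

Lemma legendre_eigenvalue_ge0 n : 0 <= legendre_eigenvalue n.
Proof. by rewrite /legendre_eigenvalue mulr_ge0. Qed.

(** The derivative - 2 n (n + 1) t P_n(t)^2 of the weighted energy has the sign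
of - t. *)
Lemma weighted_sonin_le n t : (1 - t ^+ 2) * (sonin n).[t] <= (sonin n).[0].
Proof.
have E u : (1 - u ^+ 2) * (sonin n).[u] = ((1 - 'X^2) * sonin n).[u].
  by rewrite !hornerE.
have -> : (sonin n).[0] = ((1 - 'X^2) * sonin n).[0].
  by rewrite -E expr0n subr0 mul1r.
rewrite E; have [t0|t0|->//] := ltrgtP t 0.
- have [c ct] := polyrcf.poly_mvt ((1 - 'X^2) * sonin n) t0.
  rewrite weighted_sonin_deriv => h.
  have /andP[_ c0] : t < c < 0 by move: ct; rewrite in_itv.
  have := mulr_ge0 (legendre_eigenvalue_ge0 n) (sqr_ge0 ((legendre n).[c])).
  move: h; rewrite -(mulrA (2 * c)); set q := legendre_eigenvalue n * _ => h q0.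
  have : 0 <= (- c) * (- t) * q by rewrite mulr_ge0// mulr_ge0// oppr_ge0 ltW.
  by move: h; lra.
- have [c ct] := polyrcf.poly_mvt ((1 - 'X^2) * sonin n) t0.
  rewrite weighted_sonin_deriv => h.
  have /andP[c0 _] : 0 < c < t by move: ct; rewrite in_itv.
  have := mulr_ge0 (legendre_eigenvalue_ge0 n) (sqr_ge0 ((legendre n).[c])).
  move: h; rewrite -(mulrA (2 * c)); set q := legendre_eigenvalue n * _ => h q0.
  have : 0 <= c * t * q by rewrite mulr_ge0// mulr_ge0// ltW.
  by move: h; lra.
Qed.

Lemma legendre_sqr_le n t : t ^+ 2 <= 1 ->
  (1 - t ^+ 2) * (legendre_eigenvalue n * (legendre n).[t] ^+ 2) <= (sonin n).[0].
Proof.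
move=> t1; apply: le_trans (weighted_sonin_le n t).
rewrite ler_wpM2l ?subr_ge0// sonin_hornerE lerDr.
by rewrite mulr_ge0 ?sqr_ge0 ?subr_ge0.
Qed.

(** Otherwise [legendre_sqr_le] would make P_n vanish on ]-1, 1[; the numbers
1 / (k + 2) are more roots there than the degree allows. *)
Lemma sonin0_gt0 n : (0 < n)%N -> 0 < (sonin n).[0].
Proof.
move=> n0; rewrite ltNge; apply/negP => s0.
have lam0 : 0 < legendre_eigenvalue n by rewrite /legendre_eigenvalue mulr_gt0// ltr0n.
pose rs : seq R := [seq (k.+2%:R)^-1 | k <- iota 0 (size (legendre n : {poly R}))].
have urs : uniq rs.
  rewrite map_inj_uniq ?iota_uniq// => i j /invr_inj /eqP.
  by rewrite eqr_nat => /eqP[].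
have rrs : all (root (legendre n : {poly R})) rs.
  apply/allP => _ /mapP[k _ ->]; rewrite /root.
  set t : R := k.+2%:R^-1.
  have t1 : t ^+ 2 < 1.
    by rewrite expr_lt1 ?invr_ge0// invf_lt1 ?ltr0n// ltr1n.
  have := le_trans (legendre_sqr_le n (ltW t1)) s0.
  rewrite pmulr_rle0 ?subr_gt0// pmulr_rle0// => h.
  by rewrite -sqrf_eq0 eq_le h sqr_ge0.
by have := max_poly_roots (legendre_neq0 n) rrs urs; rewrite size_map size_iota ltnn.
Qed.

Definition poly_primitive (p : {poly R}) : {poly R} :=
  \poly_(i < (size p).+1) (p`_i.-1 / i%:R).

Lemma poly_primitiveK p : (poly_primitive p)^`() = p.
Proof.
apply/polyP => i; rewrite coef_deriv coef_poly ltnS.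
have [inner_prod|inner_prod] := ltnP i (size p); last by rewrite mul0rn nth_default.
by rewrite -[LHS]mulr_natr /= divfK// pnatr_eq0.
Qed.

(** The polynomial 2 n (n + 1) Q + (1 - X^2) P_n P_n' has the energy as its
derivative, and the energy is at least its value at 0.  The second summand is
smaller than this value by a factor of order n, so for large n the increment
of Q alone is of the order of the length of the interval. *)
Lemma legendre_sqr_mass n (a b kappa : R) (Q : {poly R}) : (0 < n)%N -> a < b ->
  0 < kappa -> kappa <= 1 - a ^+ 2 -> kappa <= 1 - b ^+ 2 ->
  Q^`() = legendre n ^+ 2 ->
  2 <= n%:R * (b - a) * kappa ->
  (sonin n).[0] * (b - a) <= 4 * legendre_eigenvalue n * (Q.[b] - Q.[a]).
Proof.
move=> n0 ab k0 ka kb Q' nlarge.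
set F0 := (sonin n).[0]; have F00 : 0 < F0 := sonin0_gt0 n0.
pose U : {poly R} := (1 - 'X^2) * (legendre n * (legendre n)^`()) + (2 * legendre_eigenvalue n) *: Q.
have U' t : U^`().[t] = (sonin n).[t].
  have ode := legendre_ode n t.
  have dx2 : (1 - 'X^2 : {poly R})^`() = - (2 *: 'X).
    by rewrite !poly.derivE sub0r expr1 scaler_nat.
  rewrite sonin_hornerE /U; move: (legendre n) ode Q' => p ode Q'.
  rewrite derivD derivM derivZ Q' dx2 derivM !hornerE /= -[RHS]addr0.
  rewrite -[X in _ = _ + X](mulr0 p.[t]) -ode /legendre_eigenvalue; ring.
have bdry t : kappa <= 1 - t ^+ 2 ->
    2 * n%:R * (kappa * `|(1 - t ^+ 2) * ((legendre n).[t] * (legendre n)^`().[t])|) <= F0.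
  move=> kt; have t1 : 0 < 1 - t ^+ 2 by apply: lt_le_trans kt.
  apply: le_trans (weighted_sonin_le n t).
  rewrite sonin_hornerE mulrCA.
  set p := (legendre n).[t]; set q := (legendre n)^`().[t]; set s := 1 - t ^+ 2 in kt t1 *.
  have n2 : n%:R ^+ 2 <= legendre_eigenvalue n by rewrite /legendre_eigenvalue expr2 ler_wpM2l// ler_nat.
  apply: ler_pM => //; first exact: ltW.
  rewrite normrM gtr0_norm// normrM.
  have s1 : s <= 1 by rewrite /s lerBlDr lerDl sqr_ge0.
  have h1 : (n%:R * `|p|) ^+ 2 <= legendre_eigenvalue n * p ^+ 2.
    by rewrite exprMn real_normK ?num_real// ler_wpM2r ?sqr_ge0.
  have h2 := sqr_ge0 (n%:R * `|p| - `|q|).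
  have h3 : s * (2 * (n%:R * `|p|) * `|q|) <= s * ((n%:R * `|p|) ^+ 2 + `|q| ^+ 2).
    by rewrite ler_pM2l//; move: h2; rewrite sqrrB; lra.
  have h4 : s * (n%:R * `|p|) ^+ 2 <= 1 * (legendre_eigenvalue n * p ^+ 2).
    by apply: ler_pM => //; exact: ltW.
  move: h3; rewrite mulrDr real_normK ?num_real//; lra.
have UE t : U.[t] = (1 - t ^+ 2) * ((legendre n).[t] * (legendre n)^`().[t]) +
    2 * (legendre_eigenvalue n * Q.[t]).
  by rewrite /U; move: (legendre n) => p; rewrite hornerD !hornerM hornerZ hornerD hornerN hornerXn hornerC; ring.
have [c _] := polyrcf.poly_mvt U ab; rewrite U' !UE.
have Fc := sonin_ge n c.
have := bdry a ka; have := bdry b kb.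
set ya := (1 - a ^+ 2) * _; set yb := (1 - b ^+ 2) * _.
have nk : 0 < n%:R * kappa by rewrite mulr_gt0// ltr0n.
move=> hb ha h.
have hF : F0 * (b - a) <= (sonin n).[c] * (b - a) by rewrite ler_pM2r ?subr_gt0.
have hab : n%:R * kappa * (`|ya| + `|yb|) <= F0 by lra.
have hab2 : `|ya| + `|yb| <= F0 * (b - a) / 2.
  rewrite -(ler_pM2l nk); apply: (le_trans hab).
  have : F0 * 2 <= F0 * (n%:R * (b - a) * kappa) by rewrite ler_pM2l.
  lra.
have := ler_norm yb; have := ler_norm (- ya); rewrite normrN.
lra.
Qed.

End LegendrePolynomials.

(** * Mass of a Legendre polynomial along a vertical segment *)

Section VerticalSegment.
Context {R : realType}.
Implicit Types (r z s a b c : R).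
Local Notation leb := (@lebesgue_measure R).

(** The cosine of the polar angle of a vector of height z whose horizontal part
has squared length r. *)
Definition polar_cos r z := z / Num.sqrt (r + z ^+ 2).
Definition dpolar_cos r z := r / Num.sqrt (r + z ^+ 2) ^+ 3.

Let w r z := Num.sqrt (r + z ^+ 2).

Lemma is_derive_hypot r z : 0 < r -> is_derive z 1 (w r) ((2 * w r z)^-1 * (2 * z)).
Proof.
move=> r0; have w0 : 0 < r + z ^+ 2 by rewrite ltr_wpDr// sqr_ge0.
have d1 : is_derive z 1 (fun z => r + z ^+ 2) (2 * z).
  have := is_deriveD (is_derive_cst r z 1) (is_deriveX 2 (is_derive_id z (1 : R))).
  move=> h; apply: is_derive_eq h _ => /=.
  by rewrite add0r expr1 /GRing.scale /= mulr1.
exact: (@is_derive1_comp _ Num.sqrt (fun z => r + z ^+ 2) _ _ _ (is_derive1_sqrt w0) d1).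
Qed.

Lemma hypot_gt0 r z : 0 < r -> 0 < w r z.
Proof. by move=> r0; rewrite sqrtr_gt0 ltr_wpDr// sqr_ge0. Qed.

Lemma is_derive_polar_cos r z : 0 < r -> is_derive z 1 (polar_cos r) (dpolar_cos r z).
Proof.
move=> r0; have s0 := hypot_gt0 z r0.
have d3 := is_deriveV (lt0r_neq0 s0) (is_derive_hypot z r0).
have d4 := is_deriveM (is_derive_id z (1 : R)) d3.
apply: is_derive_eq d4 _.
rewrite /GRing.scale /= /dpolar_cos -/(w r z).
have ww : r = w r z ^+ 2 - z ^+ 2.
  by rewrite /w sqr_sqrtr ?addrK// addr_ge0 ?sqr_ge0// ltW.
by rewrite [X in _ = X / _]ww; field; rewrite gt_eqF.
Qed.

Lemma is_derive_continuous (f : R -> R) z df : is_derive z 1 f df -> {for z, continuous f}.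
Proof. by move=> [d _]; apply/differentiable_continuous/derivable1_diffP. Qed.

Lemma continuous_dpolar_cos r : 0 < r -> continuous (dpolar_cos r).
Proof.
move=> r0 z; apply: cvgM; first exact: cvg_cst.
apply: cvgV; first by rewrite gt_eqF// exprn_gt0// hypot_gt0.
apply: (@continuous_comp _ _ _ (w r) (fun x => x ^+ 3)).
  exact: is_derive_continuous (is_derive_hypot z r0).
exact: exprn_continuous.
Qed.

(** The integration variable enters through c - s since it is the height of the
second argument of the kernel; this is why the end points are swapped. *)
Lemma integral_polar_cos r a b c (p Q : {poly R}) : 0 < r -> a < b -> Q^`() = p ->
  (\int[leb]_(s in `[a, b]) (dpolar_cos r (c - s) * p.[polar_cos r (c - s)])%:E =
   (Q.[polar_cos r (c - a)] - Q.[polar_cos r (c - b)])%:E)%E.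
Proof.
move=> r0 ab Qp.
pose F s := - Q.[polar_cos r (c - s)].
have dF s : is_derive s 1 F (dpolar_cos r (c - s) * p.[polar_cos r (c - s)]).
  have d1 : is_derive s 1 (fun s => c - s) (- 1).
    by apply: is_derive_eq (is_deriveB (is_derive_cst c s 1) (is_derive_id s (1 : R))) _; rewrite sub0r.
  have d2 := @is_derive1_comp _ (polar_cos r) (fun s => c - s) _ _ _ (is_derive_polar_cos (c - s) r0) d1.
  have d3 := @is_derive1_comp _ (horner Q) (polar_cos r \o (fun s => c - s)) _ _ _ (is_derive_poly Q _) d2.
  apply: is_derive_eq (is_deriveN d3) _.
  by rewrite Qp /=; ring.
have cs : continuous (fun s : R => c - s).
  by move=> s; apply: cvgB; [exact: cvg_cst|exact: cvg_id].
have cF s := is_derive_continuous (dF s).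
have cslope s : {for s, continuous (fun s => polar_cos r (c - s))}.
  apply: (@continuous_comp _ _ _ (fun s => c - s) (polar_cos r)); first exact: cs.
  exact: is_derive_continuous (is_derive_polar_cos _ r0).
rewrite (@continuous_FTC2 _ _ F)//.
- by rewrite /F -EFinB; congr (_%:E); ring.
- apply: continuous_subspaceT => s; apply: cvgM.
    apply: (@continuous_comp _ _ _ (fun s => c - s) (dpolar_cos r)); first exact: cs.
    exact: continuous_dpolar_cos.
  apply: (@continuous_comp _ _ _ (fun s => polar_cos r (c - s)) (horner p)); first exact: cslope.
  exact: continuous_horner.
- split; first by move=> s _; case: (dF s).
  + by apply: cvg_at_right_filter; exact: cF.
  + by apply: cvg_at_left_filter; exact: cF.
- by move=> s _; rewrite derive1E; case: (dF s).
Qed.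

Lemma polar_cos_sqr r z : 0 < r -> 1 - polar_cos r z ^+ 2 = r / (r + z ^+ 2).
Proof.
move=> r0; have w0 : 0 < r + z ^+ 2 by rewrite ltr_wpDr// sqr_ge0.
by rewrite /polar_cos expr_div_n sqr_sqrtr ?ltW//; field; rewrite gt_eqF.
Qed.

Lemma polar_cos_increment r a b D : 0 < r -> a < b -> 0 < D ->
  (forall z, a <= z <= b -> r + z ^+ 2 <= D ^+ 2) ->
  r / D ^+ 3 * (b - a) <= polar_cos r b - polar_cos r a.
Proof.
move=> r0 ab D0 hD.
have [z zab ->] := @MVT _ (polar_cos r) (dpolar_cos r) a b ab
  (fun z _ => is_derive_polar_cos z r0)
  (continuous_subspaceT (fun z => is_derive_continuous (is_derive_polar_cos z r0))).
rewrite ler_pM2r ?subr_gt0// /dpolar_cos ler_pM2l// lef_pV2 ?posrE ?exprn_gt0 ?hypot_gt0//.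
rewrite lerXn2r ?nnegrE ?sqrtr_ge0 ?(ltW D0)//.
rewrite -[leRHS](@ger0_norm _ D) ?(ltW D0)// -sqrtr_sqr ler_sqrt ?sqr_ge0// hD//.
by move: zab; rewrite in_itv /= => /andP[/ltW -> /ltW ->].
Qed.

Lemma dpolar_cos_le r z : 0 < r -> 0 <= dpolar_cos r z <= (Num.sqrt r)^-1.
Proof.
move=> r0; have w0 := hypot_gt0 z r0; have s0 : 0 < Num.sqrt r by rewrite sqrtr_gt0.
have sw : Num.sqrt r <= w r z.
  by rewrite ler_sqrt ?lerDl ?sqr_ge0// addr_ge0 ?sqr_ge0// ltW.
apply/andP; split; first by rewrite divr_ge0 ?ltW// exprn_gt0.
rewrite /dpolar_cos -/(w r z) ler_pdivrMr ?exprn_gt0//.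
rewrite ler_pdivlMl//.
have -> : Num.sqrt r * r = Num.sqrt r ^+ 3 by rewrite exprS sqr_sqrtr ?ltW.
by rewrite lerXn2r// ?nnegrE ltW.
Qed.

(** Along a vertical segment the cosine of the polar angle moves with a speed
between r / D^3 and 1 / sqrt r, which transfers [legendre_sqr_mass] to an
integral over the height. *)
Lemma legendre_line_mass n r a b c D : (0 < n)%N -> 0 < r -> a < b -> 0 < D ->
  (forall s, a <= s <= b -> r + (c - s) ^+ 2 <= D ^+ 2) ->
  2 * D ^+ 5 <= n%:R * (b - a) * r ^+ 2 ->
  ((Num.sqrt r * r * (b - a) / (4 * D ^+ 3 * legendre_eigenvalue n) * (sonin n).[0])%:E <=
    \int[leb]_(s in `[a, b]) ((legendre n).[polar_cos r (c - s)] ^+ 2)%:E)%E.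
Proof.
move=> n0 r0 ab D0 hD nlarge.
have s0 : 0 < Num.sqrt r by rewrite sqrtr_gt0.
have lam0 : 0 < legendre_eigenvalue n :> R by rewrite /legendre_eigenvalue mulr_gt0 ?ltr0n.
set F0 := (sonin n).[0]; have F00 : 0 < F0 := sonin0_gt0 n0.
pose p := legendre n ^+ 2 : {poly R}.
have hI := integral_polar_cos c r0 ab (poly_primitiveK p).
have cab : c - b < c - a by rewrite ltrD2l ltrN2.
have kap z : c - b <= z <= c - a -> r / D ^+ 2 <= 1 - polar_cos r z ^+ 2.
  move=> /andP[h1 h2]; rewrite polar_cos_sqr// ler_pM2l// lef_pV2 ?posrE ?exprn_gt0//; last first.
    by rewrite ltr_wpDr// sqr_ge0.
  have -> : z = c - (c - z) by ring.
  by apply: hD; apply/andP; split; lra.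
have incr : r / D ^+ 3 * (b - a) <= polar_cos r (c - a) - polar_cos r (c - b).
  have -> : b - a = c - a - (c - b) by ring.
  apply: polar_cos_increment => // z /andP[h1 h2].
  have -> : z = c - (c - z) by ring.
  by apply: hD; apply/andP; split; lra.
have rD : 0 < r / D ^+ 2 by rewrite divr_gt0 ?exprn_gt0.
have cc : c - b <= c - b <= c - a by rewrite lexx ltW.
have cc' : c - b <= c - a <= c - a by rewrite lexx ltW.
have tab : polar_cos r (c - b) < polar_cos r (c - a).
  rewrite -subr_gt0; apply: lt_le_trans incr.
  by rewrite mulr_gt0 ?subr_gt0// divr_gt0 ?exprn_gt0.
have large : 2 <= n%:R * (polar_cos r (c - a) - polar_cos r (c - b)) * (r / D ^+ 2).
  apply: (@le_trans _ _ (n%:R * (r / D ^+ 3 * (b - a)) * (r / D ^+ 2))).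
    have -> : n%:R * (r / D ^+ 3 * (b - a)) * (r / D ^+ 2) =
        n%:R * (b - a) * r ^+ 2 / D ^+ 5 by field; rewrite gt_eqF.
    by rewrite ler_pdivlMr ?exprn_gt0.
  by rewrite ler_pM2r// ler_pM2l ?ltr0n.
have mass := legendre_sqr_mass n0 tab rD (kap _ cc) (kap _ cc') (poly_primitiveK _) large.
apply: (@le_trans _ _ (Num.sqrt r * ((poly_primitive p).[polar_cos r (c - a)] -
    (poly_primitive p).[polar_cos r (c - b)]))%:E).
  rewrite lee_fin.
  have -> : Num.sqrt r * r * (b - a) / (4 * D ^+ 3 * legendre_eigenvalue n) * F0 =
      Num.sqrt r * ((4 * legendre_eigenvalue n)^-1 * (F0 * (r / D ^+ 3 * (b - a)))).
    by field; rewrite !gt_eqF.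
  rewrite ler_pM2l// ler_pdivrMl; last by rewrite mulr_gt0.
  apply: le_trans mass.
  by rewrite -/F0 ler_pM2l.
have cp : continuous (fun s => p.[polar_cos r (c - s)]).
  move=> s; apply: (@continuous_comp _ _ _ (fun s => polar_cos r (c - s)) (horner p)).
    apply: (@continuous_comp _ _ _ (fun s => c - s) (polar_cos r)).
      by apply: cvgB; [exact: cvg_cst|exact: cvg_id].
    exact: is_derive_continuous (is_derive_polar_cos _ r0).
  exact: continuous_horner.
have cd : continuous (fun s => dpolar_cos r (c - s)).
  move=> s; apply: (@continuous_comp _ _ _ (fun s => c - s) (dpolar_cos r)).
    by apply: cvgB; [exact: cvg_cst|exact: cvg_id].
  exact: continuous_dpolar_cos.
have p0 s : 0 <= p.[polar_cos r (c - s)] by rewrite /p horner_exp sqr_ge0.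
have mcp : measurable_fun `[a, b] (fun s => p.[polar_cos r (c - s)]).
  by apply: measurable_funTS; exact: continuous_measurable_fun.
have mcd : measurable_fun `[a, b] (fun s => dpolar_cos r (c - s)).
  by apply: measurable_funTS; exact: continuous_measurable_fun.
have d0 s : 0 <= dpolar_cos r (c - s) by have /andP[] := dpolar_cos_le (c - s) r0.
rewrite EFinM -hI -ge0_integralZl_EFin//; last 2 first.
- by move=> s _; rewrite lee_fin mulr_ge0.
- by apply/measurable_EFinP; exact: measurable_funM.
- have -> : (\int[leb]_(s in `[a, b]) ((legendre n).[polar_cos r (c - s)] ^+ 2)%:E =
      \int[leb]_(s in `[a, b]) (p.[polar_cos r (c - s)])%:E)%E.
    by apply: eq_integral => s _; rewrite /p horner_exp.
  apply: ge0_le_integral => //.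
  + by move=> s _; rewrite -EFinM lee_fin !mulr_ge0// ltW.
  + apply: emeasurable_funM => //; apply/measurable_EFinP.
    exact: measurable_funM.
  + exact/measurable_EFinP.
  + move=> s _; rewrite -EFinM lee_fin mulrA ler_piMl//.
    have /andP[_ dle] := dpolar_cos_le (c - s) r0.
    by rewrite mulrC -ler_pdivlMr// div1r.
Qed.
End VerticalSegment.

(** * Orthogonal systems of square-integrable functions *)

Section InnerProduct.
Context d (T : measurableType d) (R : realType).
Variable mu : {measure set T -> \bar R}.
Implicit Types f g h u v w : T -> R.

Local Notation L2 := (Lfun mu 2%:E).

Lemma L2_measurable f : f \in L2 -> measurable_fun setT f.
Proof. by rewrite inE => /andP[/[!inE]/=]. Qed.

Lemma L2P f : measurable_fun setT f ->
  mu.-integrable setT (EFin \o (fun x => f x ^+ 2)) -> f \in L2.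
Proof.
move=> mf /integrableP[_ fi]; rewrite inE; apply/andP; split; rewrite inE//=.
rewrite /finite_norm unlock poweR_lty//.
rewrite (eq_integral (fun x => `|(f x ^+ 2)%:E|%E))// => x _ /=.
by rewrite powR_mulrn// normrX.
Qed.

Lemma L2_mul_integrable f g : f \in L2 -> g \in L2 ->
  mu.-integrable setT (EFin \o (fun x => f x * g x)).
Proof. by move=> f2 g2; apply/Lfun1_integrable; exact: Lfun2_mul_Lfun1. Qed.

Lemma L2_dominated f g : measurable_fun setT f -> g \in L2 ->
  (forall x, `|f x| <= `|g x|) -> f \in L2.
Proof.
move=> mf g2 fg; apply: L2P => //.
apply: (le_integrable _ _ _ (Lfun2_integrable_sqr g2)) => //.
- by apply/measurable_EFinP; exact: measurable_funX.
- by move=> x _; rewrite /= lee_fin !normrX lerXn2r ?nnegrE.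
Qed.

Lemma L2_subZ f g (c : R) : f \in L2 -> g \in L2 ->
  (fun x => f x - c * g x) \in L2.
Proof.
move=> f2 g2.
have -> : (fun x => f x - c * g x) = f + (- c) \o* g.
  by apply/funext => x /=; rewrite [in RHS]fctE /= mulrC mulrN mulrC.
have [_ ] := Lfun_addr_closed mu (lee1n 2); apply => //.
by apply: Lfun_scale => //; rewrite ler1n.
Qed.

Definition inner_prod f g : R := \int[mu]_x (f x * g x).

Lemma inner_prodC f g : inner_prod f g = inner_prod g f.
Proof. by rewrite /inner_prod; under eq_Rintegral do rewrite mulrC. Qed.

Lemma inner_prod_ge0 f : 0 <= inner_prod f f.
Proof. by apply: Rintegral_ge0 => x _; rewrite -expr2 sqr_ge0. Qed.

Lemma inner_prod_subZl f g h (c : R) : f \in L2 -> g \in L2 -> h \in L2 ->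
  inner_prod (fun x => f x - c * g x) h = inner_prod f h - c * inner_prod g h.
Proof.
move=> f2 g2 h2; rewrite /inner_prod.
under eq_Rintegral do rewrite mulrBl -mulrA.
rewrite RintegralB//; first by rewrite RintegralZl//; exact: L2_mul_integrable.
- exact: L2_mul_integrable.
- have := integrableZl measurableT c (L2_mul_integrable g2 h2).
  by apply: eq_integrable => // x _.
Qed.

Lemma inner_prod_sqr_subZ f g (c : R) : f \in L2 -> g \in L2 ->
  inner_prod (fun x => f x - c * g x) (fun x => f x - c * g x) =
  inner_prod f f - 2 * c * inner_prod f g + c ^+ 2 * inner_prod g g.
Proof.
move=> f2 g2; have fg2 := L2_subZ c f2 g2.
rewrite inner_prod_subZl// ![inner_prod _ (fun x => _ - _)]inner_prodC !inner_prod_subZl// (inner_prodC g f); ring.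
Qed.

Lemma inner_prod_cauchy_schwarz f g : f \in L2 -> g \in L2 ->
  inner_prod f g ^+ 2 <= inner_prod f f * inner_prod g g.
Proof.
move=> f2 g2.
have pos c : 0 <= inner_prod f f - 2 * c * inner_prod f g + c ^+ 2 * inner_prod g g.
  by rewrite -inner_prod_sqr_subZ// inner_prod_ge0.
have [gg0|gg0] := eqVneq (inner_prod g g) 0; last first.
  have gg_gt0 : 0 < inner_prod g g by rewrite lt_def gg0 inner_prod_ge0.
  have := pos (inner_prod f g / inner_prod g g).
  rewrite -(ler_pM2r gg_gt0) mul0r; set a := inner_prod g g; set b := inner_prod f g.
  have -> : (inner_prod f f - 2 * (b / a) * b + (b / a) ^+ 2 * a) * a = inner_prod f f * a - b ^+ 2.
    by rewrite /a; field.
  by rewrite subr_ge0.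
rewrite gg0 mulr0.
have [->|fg0] := eqVneq (inner_prod f g) 0; first by rewrite expr0n.
have := pos ((inner_prod f f + 1) / (2 * inner_prod f g)); rewrite gg0 mulr0 addr0.
have -> : 2 * ((inner_prod f f + 1) / (2 * inner_prod f g)) * inner_prod f g = inner_prod f f + 1 by field.
by lra.
Qed.

(** Peeling off one vector at a time avoids families of coefficients and makes the
span amenable to induction on the list. *)
Fixpoint in_span (e : seq (T -> R)) v : Prop :=
  if e is u :: e' then exists c : R, in_span e' (fun x => v x - c * u x)
  else v = cst 0.

(** Vectors of norm 0 are allowed: a null function cannot be normalized, and
discarding it would preserve identities only almost everywhere. *)
Definition orthosystem (e : seq (T -> R)) :=
  [&& all (fun u => u \in L2) e, all (fun u => inner_prod u u \in [:: 0; 1]) e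
    & pairwise (fun u w => inner_prod u w == 0) e].

Lemma eq_in_span e v w : v =1 w -> in_span e v -> in_span e w.
Proof. by move=> /funext ->. Qed.

Lemma in_span_subZ e v w (c : R) :
  in_span e v -> in_span e w -> in_span e (fun x => v x - c * w x).
Proof.
elim: e v w => [|u e IH] v w /=.
  by move=> -> ->; apply/funext => x /=; rewrite mulr0 subr0.
move=> [a va] [b wb]; exists (a - c * b).
by apply: eq_in_span (IH _ _ va wb) => x; ring.
Qed.

Lemma in_span_cons u e v : in_span e v -> in_span (u :: e) v.
Proof. by move=> ev; exists 0; apply: eq_in_span ev => x /=; ring. Qed.

Lemma in_span_sum (I : Type) (r : seq I) (h : I -> T -> R) (c : I -> R) :
  in_span [seq h i | i <- r] (fun y => \sum_(i <- r) c i * h i y).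
Proof.
elim: r => [|i r IH] /=; first by apply/funext => y; rewrite big_nil.
by exists (c i); apply: eq_in_span IH => y; rewrite big_cons; ring.
Qed.

Lemma in_span_cat e1 e2 v w :
  in_span e1 v -> in_span e2 w -> in_span (e1 ++ e2) (fun y => v y + w y).
Proof.
elim: e1 v => [|u e1 IH] v /=.
  by move=> -> e2w; apply: eq_in_span e2w => y; rewrite add0r.
move=> [c e1v] e2w; exists c; apply: eq_in_span (IH _ e1v e2w) => y; ring.
Qed.
Lemma in_span_L2 e v : all (fun u => u \in L2) e -> in_span e v -> v \in L2.
Proof.
elim: e v => [|u e IH] v /=.
  move=> _ ->; apply: L2P => //.
  have := integrable0 mu setT; apply: eq_integrable => // x _ /=.
  by rewrite expr0n.
move=> /andP[u2 e2] [c /(IH _ e2) h2].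
have -> : v = (fun x => (v x - c * u x) - (- c) * u x).
  by apply/funext => x; ring.
exact: L2_subZ.
Qed.

Lemma orthosystem_cons u e : orthosystem (u :: e) ->
  [/\ u \in L2, inner_prod u u \in [:: 0; 1], all (fun w => inner_prod u w == 0) e & orthosystem e].
Proof.
by rewrite /orthosystem /= => /and3P[/andP[-> ->] /andP[-> ->] /andP[-> ->]].
Qed.

Lemma orthosystem_L2 e : orthosystem e -> all (fun u => u \in L2) e.
Proof. by case/and3P. Qed.

(** If u has norm 0, then v is orthogonal to u by the Cauchy-Schwarz inequality. *)
Lemma inner_prod_unitl u v : u \in L2 -> v \in L2 -> inner_prod u u \in [:: 0; 1] ->
  inner_prod v u * inner_prod u u = inner_prod v u.
Proof.
move=> u2 v2; rewrite !inE => /orP[/eqP uu|/eqP->]; last by rewrite mulr1.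
have := inner_prod_cauchy_schwarz v2 u2; rewrite uu mulr0 => h.
have /eqP : inner_prod v u ^+ 2 = 0 by apply/eqP; rewrite eq_le h sqr_ge0.
by rewrite sqrf_eq0 => /eqP ->; rewrite mul0r.
Qed.

Lemma inner_prod_span_orthogonal e u s : all (fun w => w \in L2) e -> u \in L2 ->
  all (fun w => inner_prod u w == 0) e -> in_span e s -> inner_prod u s = 0.
Proof.
elim: e s => [|w e IH] s /=.
  move=> _ _ _ ->; rewrite /inner_prod; under eq_Rintegral do rewrite mulr0.
  by rewrite /Rintegral integral0.
move=> /andP[w2 e2] u2 /andP[/eqP uw ue] [c sc].
have h2 := in_span_L2 e2 sc.
have -> : s = (fun x => (s x - c * w x) - (- c) * w x) by apply/funext => x; ring.
rewrite inner_prodC inner_prod_subZl// (inner_prodC w) uw inner_prodC (IH _ e2 u2 ue sc); ring.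
Qed.

Lemma sum_inner_prod_subZ e u v (c : R) : u \in L2 -> v \in L2 ->
  all (fun w => w \in L2) e -> all (fun w => inner_prod u w == 0) e ->
  \sum_(w <- e) inner_prod (fun x => v x - c * u x) w ^+ 2 = \sum_(w <- e) inner_prod v w ^+ 2.
Proof.
move=> u2 v2; elim: e => [|w e IH] /=; first by rewrite !big_nil.
move=> /andP[w2 e2] /andP[/eqP uw ue].
by rewrite !big_cons IH// inner_prod_subZl// uw mulr0 subr0.
Qed.

(** Each vector u of norm 1 in the system contributes the completed square
(c - <v, u>)^2 - <v, u>^2, where c is the coefficient of w on u. *)
Lemma dist_span e v w : orthosystem e -> v \in L2 -> in_span e w ->
  inner_prod v v - \sum_(u <- e) inner_prod v u ^+ 2 <=
  inner_prod (fun x => v x - w x) (fun x => v x - w x).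
Proof.
elim: e v w => [|u e IH] v w.
  move=> _ _ -> /=; rewrite big_nil subr0.
  by have -> : (fun x => v x - (cst 0 : T -> R) x) = v
    by apply/funext => x; exact: subr0.
move=> /orthosystem_cons[u2 uu ue eo] v2 /= [c wc].
have v'2 := L2_subZ c v2 u2.
have := IH _ _ eo v'2 wc.
rewrite sum_inner_prod_subZ// ?orthosystem_L2//.
have -> : (fun x => v x - c * u x - (w x - c * u x)) = (fun x => v x - w x).
  by apply/funext => x; ring.
apply: le_trans; rewrite big_cons inner_prod_sqr_subZ//.
have h := inner_prod_unitl u2 v2 uu.
move: uu; rewrite !inE => /orP[/eqP uu|/eqP uu].
  by move: h; rewrite uu mulr0 => <-; lra.
rewrite uu; have := sqr_ge0 (c - inner_prod v u); rewrite !sqrrB !expr2; lra.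
Qed.

Lemma bessel e v : orthosystem e -> v \in L2 ->
  \sum_(u <- e) inner_prod v u ^+ 2 <= inner_prod v v.
Proof.
elim: e v => [|u e IH] v; first by rewrite big_nil inner_prod_ge0.
move=> /orthosystem_cons[u2 uu ue eo] v2.
have := IH _ eo (L2_subZ (inner_prod v u) v2 u2).
rewrite sum_inner_prod_subZ// ?orthosystem_L2// big_cons inner_prod_sqr_subZ//.
have := inner_prod_unitl u2 v2 uu; rewrite !expr2 -!mulrA => ->; lra.
Qed.

Lemma orthogonal_residual e v : orthosystem e -> v \in L2 ->
  exists h, [/\ h \in L2, all (fun w => inner_prod h w == 0) e &
    in_span e (fun x => v x - h x)].
Proof.
elim: e v => [|u e IH] v.
  by move=> _ v2; exists v; split => //=; apply/funext => x /=; rewrite subrr.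
move=> /orthosystem_cons[u2 uu ue eo] v2.
have v'2 := L2_subZ (inner_prod v u) v2 u2.
have [h [h2 he hs]] := IH _ eo v'2.
have e2 := orthosystem_L2 eo.
exists h; split => //=; last first.
  by exists (inner_prod v u); apply: eq_in_span hs => x; ring.
rewrite he andbT.
have := inner_prod_span_orthogonal e2 u2 ue hs.
have -> : (fun x => v x - inner_prod v u * u x - h x) =
          (fun x => (v x - inner_prod v u * u x) - 1 * h x) by apply/funext => x; ring.
rewrite inner_prodC inner_prod_subZl// inner_prod_subZl// (inner_prod_unitl u2 v2 uu).
by rewrite subrr mul1r sub0r => /eqP; rewrite oppr_eq0.
Qed.

Lemma normalize h : h \in L2 -> exists (c : R) u,
  [/\ u \in L2, inner_prod u u \in [:: 0; 1], h = (fun x => c * u x) &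
      forall w, w \in L2 -> inner_prod h w = 0 -> inner_prod u w = 0].
Proof.
move=> h2; have [hh|hh] := eqVneq (inner_prod h h) 0.
  exists 1, h; split => //; first by rewrite hh inE eqxx.
  by apply/funext => x; rewrite mul1r.
have hh0 : 0 < inner_prod h h by rewrite lt_def hh inner_prod_ge0.
pose s := Num.sqrt (inner_prod h h).
have s0 : s != 0 by rewrite gt_eqF// sqrtr_gt0.
have ss : s ^+ 2 = inner_prod h h by rewrite sqr_sqrtr// ltW.
pose u := fun x => cst 0 x - (- s^-1) * h x.
have c2 : (cst 0 : T -> R) \in L2 by exact: (@in_span_L2 [::]).
have c0 w : inner_prod (cst 0) w = 0.
  by rewrite /inner_prod; under eq_Rintegral do rewrite mul0r; rewrite /Rintegral integral0.
exists s, u; split.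
- exact: L2_subZ.
- by rewrite inner_prod_sqr_subZ// !c0 -ss !inE; apply/orP; right; apply/eqP; field.
- by apply/funext => x; rewrite /u /=; field.
- by move=> w w2 hw; rewrite inner_prod_subZl// c0 hw mulr0 subr0.
Qed.

Lemma gram_schmidt gs : all (fun g => g \in L2) gs ->
  exists e, [/\ orthosystem e, size e = size gs &
    forall v, in_span gs v -> in_span e v].
Proof.
elim: gs => [|g gs IH] /=; first by move=> _; exists [::]; split.
move=> /andP[g2 /IH[e [eo es eP]]].
have [h [h2 he hs]] := orthogonal_residual eo g2.
have [c [u [u2 uu hu up]]] := normalize h2.
have gu : in_span (u :: e) g.
  by exists c; apply: eq_in_span hs => x; rewrite hu.
have ue : all (fun w => inner_prod u w == 0) e.
  have /= := orthosystem_L2 eo; elim: (e) he => //= w e' IH' /andP[/eqP hw he'].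
  by move=> /andP[w2 e'2]; rewrite (up _ w2 hw) eqxx IH'.
exists (u :: e); split => /=.
- by move: eo; rewrite /orthosystem /= u2 uu ue.
- by rewrite es.
- move=> v [a /eP/(in_span_cons u) va].
  by apply: eq_in_span (in_span_subZ (- a) va gu) => x; ring.
Qed.

End InnerProduct.

(** * Norms and components of complex square-integrable functions *)

Section L2normTheory.
Context d (T : measurableType d) (R : realType) (mu : {measure set T -> \bar R}).

Lemma L2norm_sqr (D : set T) (f : T -> R) :
  (L2norm mu D f `^ 2 = \int[mu]_x (((f \_ D) x) ^+ 2)%:E)%E.
Proof.
rewrite /L2norm powR_Lnorm//; apply: eq_integral => x _.
rewrite !patchE; case: ifPn => _ /=.
  by rewrite powR_mulrn// real_normK ?num_real.
by rewrite expr0n /= normr0 powR0.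
Qed.

Lemma L2norm_ge0 (D : set T) (f : T -> R) : (0 <= L2norm mu D f)%E.
Proof. exact: Lnorm_ge0. Qed.

Lemma L2norm_L2 (D : set T) (f : T -> R) : f \_ D \in Lfun mu 2%:E ->
  fine (L2norm mu D f) = Num.sqrt (inner_prod mu (f \_ D) (f \_ D)).
Proof.
move=> f2; have := L2norm_sqr D f.
have -> : (\int[mu]_x (((f \_ D) x) ^+ 2)%:E = (inner_prod mu (f \_ D) (f \_ D))%:E)%E.
  rewrite /inner_prod /Rintegral fineK; first by apply: eq_integral => x _; rewrite expr2.
  exact: integrable_fin_num (L2_mul_integrable f2 f2).
have := L2norm_ge0 D f; case: (L2norm mu D f) => [a| |]//.
  rewrite lee_fin poweR_EFin => a0 []; rewrite powR_mulrn// => <-.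
  by rewrite sqrtr_sqr ger0_norm.
by rewrite poweRyr.
Qed.

Lemma L2norm_le_sqr (D : set T) (f g : T -> R) (eps : R) : 0 <= eps ->
  (L2norm mu D f <= eps%:E * L2norm mu D g)%E ->
  (\int[mu]_x (((f \_ D) x) ^+ 2)%:E <=
   (eps ^+ 2)%:E * \int[mu]_x (((g \_ D) x) ^+ 2)%:E)%E.
Proof.
move=> e0 fg; rewrite -!L2norm_sqr.
have -> : ((eps ^+ 2)%:E * L2norm mu D g `^ 2 = (eps%:E * L2norm mu D g) `^ 2)%E.
  by rewrite poweRM ?L2norm_ge0// poweR_EFin powR_mulrn.
by rewrite gt0_ler_poweR// in_itv /= leey ?L2norm_ge0// mule_ge0// L2norm_ge0.
Qed.

Lemma indic_integrable (A : set T) : measurable A -> (mu A < +oo)%E ->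
  mu.-integrable setT (EFin \o (\1_A : T -> R)).
Proof.
move=> mA fA; apply/integrableP; split; first exact/measurable_EFinP/measurable_indic.
rewrite (eq_integral (fun x => (\1_A x)%:E)); first by rewrite integral_indic// setIT.
by move=> x _ /=; rewrite ger0_norm.
Qed.

Lemma indic_L2 (A : set T) (c : R) : measurable A -> (mu A < +oo)%E ->
  (fun x => c * \1_A x) \in Lfun mu 2%:E.
Proof.
move=> mA fA; have mf : measurable_fun setT (fun x => c * \1_A x).
  by apply: measurable_funM => //; exact: measurable_indic.
apply: L2P => //.
have i1 := indic_integrable mA fA.
have := integrableZl measurableT (c ^+ 2) i1; apply: eq_integrable => // x _ /=.
by rewrite exprMn indicE; case: (x \in A); rewrite ?expr1n ?expr0n.
Qed.

Lemma normc_restrict_sqr (D : set T) (F : T -> R[i]) x :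
  ((fun x => Normc.normc (F x)) \_ D) x ^+ 2 =
  ((fun x => complex.Re (F x)) \_ D) x ^+ 2 + ((fun x => complex.Im (F x)) \_ D) x ^+ 2.
Proof.
rewrite !patchE; case: ifPn => _; last by rewrite expr0n addr0.
by case: (F x) => a b /=; rewrite sqr_sqrtr// addr_ge0 ?sqr_ge0.
Qed.

Lemma in_cL2_ReIm (D : set T) (F : T -> R[i]) : measurable D -> in_cL2 mu D F ->
  (fun x => complex.Re (F x)) \_ D \in Lfun mu 2%:E /\
  (fun x => complex.Im (F x)) \_ D \in Lfun mu 2%:E.
Proof.
move=> mD [mR mI fin].
have mR' := (measurable_restrictT _ mD).1 mR.
have mI' := (measurable_restrictT _ mD).1 mI.
have fin2 : (\int[mu]_x (((fun x => complex.Re (F x)) \_ D) x ^+ 2 +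
    ((fun x => complex.Im (F x)) \_ D) x ^+ 2)%:E < +oo)%E.
  under eq_integral do rewrite -normc_restrict_sqr.
  by rewrite -L2norm_sqr; exact: poweR_lty.
have i12 : mu.-integrable setT (EFin \o (fun x => ((fun x => complex.Re (F x)) \_ D) x ^+ 2 +
    ((fun x => complex.Im (F x)) \_ D) x ^+ 2)).
  apply/integrableP; split.
    by apply/measurable_EFinP; apply: measurable_funD; exact: measurable_funX.
  apply: le_lt_trans fin2; rewrite le_eqVlt; apply/orP; left; apply/eqP.
  by apply: eq_integral => x _ /=; rewrite ger0_norm// addr_ge0 ?sqr_ge0.
by split; apply: L2P => //; apply: (le_integrable _ _ _ i12) => //;
  try (by apply/measurable_EFinP; exact: measurable_funX);
  move=> x _; rewrite /= lee_fin !ger0_norm ?addr_ge0 ?sqr_ge0// ?lerDl ?lerDr sqr_ge0.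
Qed.

End L2normTheory.

(** * A lower bound on the rank of approximations of a kernel *)

(** The positive and negative parts are treated separately, so that f need not be
integrable on the product. *)
Lemma measurable_Rintegral2 d1 d2 (S : measurableType d1) (T : measurableType d2)
    (R : realType) (nu : {sigma_finite_measure set T -> \bar R}) (f : S * T -> R) :
  measurable_fun setT f -> measurable_fun setT (fun x => \int[nu]_y f (x, y)).
Proof.
move=> mf; apply: measurableT_comp => //.
have mF : measurable_fun setT (EFin \o f) by exact/measurable_EFinP.
rewrite (_ : (fun x => _) =
    (fun x => (\int[nu]_y (EFin \o f)^\+ (x, y) - \int[nu]_y (EFin \o f)^\- (x, y))%E)).
  by apply: emeasurable_funB; apply: measurable_fun_fubini_tonelli_F => //;
     [exact: measurable_funepos|exact: measurable_funeneg].
apply/funext => x; rewrite [LHS]integralE.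
by congr (_ - _)%E; apply: eq_integral => y _; rewrite ?funeposE ?funenegE.
Qed.

Definition swapk (S T R : Type) (G : S * T -> R) : T * S -> R :=
  fun z => G (z.2, z.1).

Section KernelOperator.
Context d1 d2 (S : measurableType d1) (T : measurableType d2) (R : realType).
Variables (mu : {sigma_finite_measure set S -> \bar R})
          (nu : {sigma_finite_measure set T -> \bar R}).
Variables (G : S * T -> R) (phi : S -> R) (psi : T -> R).
Hypotheses (mG : measurable_fun setT G)
  (phi2 : phi \in Lfun mu 2%:E) (psi2 : psi \in Lfun nu 2%:E)
  (Gdom : forall x y, `|G (x, y)| <= `|phi x * psi y|).

Definition kernel_op (e : T -> R) (x : S) : R := inner_prod nu (fun y => G (x, y)) e.

(** Domination by a product phi(x) psi(y) makes all sections square-integrable,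
not only almost all of them. *)
Lemma kernel_section_L2 x : (fun y => G (x, y)) \in Lfun nu 2%:E.
Proof.
apply: (L2_dominated (g := fun y => phi x * psi y)) => //.
  exact: measurableT_comp mG (pair1_measurable x).
have -> : (fun y => phi x * psi y) = phi x \o* psi by apply/funext => y; rewrite mulrC.
by apply: Lfun_scale => //; rewrite ler1n.
Qed.

Lemma kernel_op_le e x : e \in Lfun nu 2%:E ->
  `|kernel_op e x| <= `|phi x| * \int[nu]_y `|psi y * e y|.
Proof.
move=> e2; have i1 := L2_mul_integrable (kernel_section_L2 x) e2.
apply: (le_trans (le_normr_Rintegral measurableT i1)).
have i2 := integrable_norm (L2_mul_integrable psi2 e2).
rewrite -RintegralZl//; apply: le_Rintegral => //.
- exact: integrable_norm i1.
- by have := integrableZl measurableT `|phi x| i2; apply: eq_integrable => // y _.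
- move=> y _; rewrite !normrM mulrA; apply: ler_wpM2r => //.
  by rewrite -normrM.
Qed.

Lemma kernel_op_L2 e : e \in Lfun nu 2%:E -> kernel_op e \in Lfun mu 2%:E.
Proof.
move=> e2; have me := L2_measurable e2.
set c := \int[nu]_y `|psi y * e y|.
apply: (L2_dominated (g := c \o* phi)).
- refine (measurable_Rintegral2 nu (f := fun z => G z * e z.2) _).
  by apply: measurable_funM => //; exact: measurableT_comp.
- by apply: Lfun_scale => //; rewrite ler1n.
- move=> x; apply: (le_trans (kernel_op_le x e2)).
  by rewrite /= normrM; apply: ler_wpM2l => //; exact: ler_norm.
Qed.

End KernelOperator.

Section KernelAdjoint.
Context d1 d2 (S : measurableType d1) (T : measurableType d2) (R : realType).
Variables (mu : {sigma_finite_measure set S -> \bar R})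
          (nu : {sigma_finite_measure set T -> \bar R}).
Variables (G : S * T -> R) (phi : S -> R) (psi : T -> R).
Hypotheses (mG : measurable_fun setT G)
  (phi2 : phi \in Lfun mu 2%:E) (psi2 : psi \in Lfun nu 2%:E)
  (Gdom : forall x y, `|G (x, y)| <= `|phi x * psi y|).

Local Notation kadj := (kernel_op mu (swapk G)).

Lemma measurable_swapk : measurable_fun setT (swapk G).
Proof. by apply: measurableT_comp mG _; exact: measurable_fun_pair. Qed.

Lemma swapk_dom y x : `|swapk G (y, x)| <= `|psi y * phi x|.
Proof. by rewrite /swapk /= mulrC. Qed.

(** Fubini's theorem, applicable since the integrand is dominated by the product
of the integrable functions phi u and psi e. *)
Lemma kernel_op_adjoint u e : u \in Lfun mu 2%:E -> e \in Lfun nu 2%:E ->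
  inner_prod mu (kernel_op nu G e) u = inner_prod nu e (kadj u).
Proof.
move=> u2 e2; have [mu_ me] := (L2_measurable u2, L2_measurable e2).
pose f z := G z * e z.2 * u z.1.
have mf : measurable_fun setT f.
  by apply: measurable_funM; [apply: measurable_funM => //|]; exact: measurableT_comp.
have intf : (mu \x nu)%E.-integrable setT (EFin \o f).
  apply/integrable12ltyP; first exact/measurable_EFinP.
  have ie := integrable_norm (L2_mul_integrable psi2 e2).
  have iu := integrable_norm (L2_mul_integrable phi2 u2).
  have /integrableP[_] := integrableZl measurableT (\int[nu]_y `|psi y * e y|) iu.
  apply: le_lt_trans; apply: ge0_le_integral => //.
  - by move=> x _; exact: integral_ge0.
  - apply: (measurable_fun_fubini_tonelli_F (fun z => `|(f z)%:E|%E)) => //.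
    by apply: measurableT_comp => //; exact/measurable_EFinP.
  - apply: measurableT_comp => //; apply: emeasurable_funM => //.
    exact: measurable_int iu.
  - move=> x _ /=; rewrite ger0_norm; last first.
      by rewrite mulr_ge0// Rintegral_ge0.
    rewrite EFinM muleC fineK; last exact: integrable_fin_num ie.
    rewrite -integralZl//; apply: ge0_le_integral => //.
    + apply/measurable_EFinP; apply: measurableT_comp => //.
      exact: measurableT_comp mf (pair1_measurable x).
    + by apply: emeasurable_funM => //; exact: measurable_int ie.
    + move=> y _ /=; rewrite -EFinM lee_fin /f /= !normrM.
      have -> : `|phi x| * `|u x| * (`|psi y| * `|e y|) =
        `|phi x * psi y| * `|e y| * `|u x| by rewrite normrM; ring.
      by do 2 apply: ler_wpM2r => //.
have kE x : (\int[nu]_y (f (x, y))%:E = (kernel_op nu G e x * u x)%:E)%E.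
  rewrite /kernel_op /inner_prod -RintegralZr//; last exact: L2_mul_integrable (kernel_section_L2 mG psi2 Gdom x) e2.
  rewrite [RHS]fineK//; apply: integrable_fin_num => //.
  have i1 := L2_mul_integrable (kernel_section_L2 mG psi2 Gdom x) e2.
  by have := integrableZr measurableT (u x) i1; apply: eq_integrable => // y _.
have kadjE y : (\int[mu]_x (f (x, y))%:E = (e y * kadj u y)%:E)%E.
  have i1 := L2_mul_integrable (kernel_section_L2 measurable_swapk phi2 swapk_dom y) u2.
  rewrite /kernel_op /inner_prod -RintegralZl//.
  under eq_integral do rewrite /f /= mulrC (mulrC (G _)) mulrA mulrC.
  rewrite [RHS]fineK.
    by apply: eq_integral => x _; congr (_%:E); rewrite /swapk /=; ring.
  apply: integrable_fin_num => //.
  by have := integrableZl measurableT (e y) i1; apply: eq_integrable => // x _.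
rewrite /inner_prod /Rintegral; congr fine.
rewrite -(eq_integral _ _ (fun x _ => kE x)) -(eq_integral _ _ (fun y _ => kadjE y)).
exact: Fubini intf.
Qed.

End KernelAdjoint.

Lemma sqr_sum_le (R : realFieldType) (I : Type) (r : seq I) (a : I -> R) :
  (\sum_(i <- r) a i) ^+ 2 <= (size r)%:R * \sum_(i <- r) a i ^+ 2.
Proof.
elim: r => [|i r IH]; first by rewrite !big_nil expr0n mul0r.
rewrite !big_cons /= -natr1.
set s := \sum_(j <- r) a j in IH *; set q := \sum_(j <- r) _ in IH *.
have [r0|r0] := posnP (size r).
  have : r = [::] by case: (r) r0.
  by move=> r'; move: @s @q IH; rewrite r' !big_nil /= => _; lra.
have n0 : 0 < (size r)%:R :> R by rewrite ltr0n.
move: (size r)%:R n0 IH => n n0 IH.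
have : 0 <= n * (n * a i ^+ 2 + q - 2 * (a i * s)).
  have := sqr_ge0 (n * a i - s); move: IH; rewrite !expr2; lra.
rewrite pmulr_rge0//; move: IH; rewrite !expr2; lra.
Qed.

Section FiniteRankBound.
Context d1 d2 (S : measurableType d1) (T : measurableType d2) (R : realType).
Variables (mu : {sigma_finite_measure set S -> \bar R})
          (nu : {sigma_finite_measure set T -> \bar R}).
Variables (G : S * T -> R) (phi : S -> R) (psi : T -> R).
Hypotheses (mG : measurable_fun setT G)
  (phi2 : phi \in Lfun mu 2%:E) (psi2 : psi \in Lfun nu 2%:E)
  (Gdom : forall x y, `|G (x, y)| <= `|phi x * psi y|).

(** The kernel of G^* G, where G denotes the operator [kernel_op]. *)
Definition gram_kernel (y : T) : T -> R := kernel_op mu (swapk G) (fun x => G (x, y)).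

Let sG x := kernel_section_L2 mG psi2 Gdom x.
Let tG y : (fun x => G (x, y)) \in Lfun mu 2%:E :=
  kernel_section_L2 (measurable_swapk mG) phi2 (swapk_dom Gdom) y.
Let kadjL2 u : u \in Lfun mu 2%:E -> kernel_op mu (swapk G) u \in Lfun nu 2%:E :=
  @kernel_op_L2 _ _ _ _ _ _ _ _ _ _ (measurable_swapk mG) psi2 phi2 (swapk_dom Gdom) u.

Lemma kernel_sqr_integrable : mu.-integrable setT
  (EFin \o (fun x => inner_prod nu (fun y => G (x, y)) (fun y => G (x, y)))).
Proof.
have i1 := integrableZl measurableT (inner_prod nu psi psi) (L2_mul_integrable phi2 phi2).
apply: (le_integrable _ _ _ i1) => //.
  apply/measurable_EFinP.
  refine (measurable_Rintegral2 nu (f := fun z => G z * G z) _).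
  exact: measurable_funM.
move=> x _ /=; rewrite lee_fin ger0_norm ?inner_prod_ge0// ger0_norm; last first.
  by rewrite mulr_ge0 ?inner_prod_ge0// -expr2 sqr_ge0.
rewrite mulrC /inner_prod -RintegralZl//; last exact: L2_mul_integrable.
apply: le_Rintegral => //.
- exact: L2_mul_integrable.
- have := integrableZl measurableT (phi x * phi x) (L2_mul_integrable psi2 psi2).
  by apply: eq_integrable => // y _.
- move=> y _; have := Gdom x y; rewrite -ler_sqr ?nnegrE// !real_normK ?num_real//.
  by rewrite !expr2 [phi x * psi y * _]mulrACA.
Qed.

Lemma kernel_sqr_integral : (\int[mu \x nu]_z (G z ^+ 2)%:E =
  (\int[mu]_x inner_prod nu (fun y => G (x, y)) (fun y => G (x, y)))%R%:E)%E.
Proof.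
rewrite fubini_tonelli1//=.
- rewrite /Rintegral fineK; last exact: integrable_fin_num kernel_sqr_integrable.
  apply: eq_integral => x _; rewrite /inner_prod /Rintegral fineK.
    by apply: eq_integral => y _; rewrite expr2.
  exact: integrable_fin_num (L2_mul_integrable (sG x) (sG x)).
- by apply/measurable_EFinP; exact: measurable_funX.
- by move=> z; rewrite lee_fin sqr_ge0.
Qed.

Lemma gram_kernel_L2 y : gram_kernel y \in Lfun nu 2%:E.
Proof. exact: kadjL2. Qed.

(** Both sides are <G^* G e, e>. *)
Lemma inner_prod_kernel_op e : e \in Lfun nu 2%:E ->
  inner_prod mu (kernel_op nu G e) (kernel_op nu G e) = inner_prod nu e (fun y => inner_prod nu (gram_kernel y) e).
Proof.
move=> e2; have k2 := kernel_op_L2 mG phi2 psi2 Gdom e2.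
rewrite (kernel_op_adjoint mG phi2 psi2 Gdom)//.
congr (inner_prod nu e _); apply/funext => y.
rewrite {1}/kernel_op inner_prodC (kernel_op_adjoint mG phi2 psi2 Gdom)//; last exact: tG.
by rewrite inner_prodC.
Qed.

(** The square of <G^* G e, e> is at most the squared norm of G^* G e, because e
has norm at most 1.  The value of G^* G e at y is the product of e with the
row of the Gram kernel at y, so Bessel's inequality at each y bounds the sum
over e; no orthogonal system on the product space is needed. *)
Lemma sum_kernel_op_sqr (chi : T -> R) es : orthosystem nu es ->
  nu.-integrable setT (EFin \o chi) ->
  (forall y, inner_prod nu (gram_kernel y) (gram_kernel y) <= chi y) ->
  \sum_(e <- es) inner_prod mu (kernel_op nu G e) (kernel_op nu G e) ^+ 2 <= \int[nu]_y chi y.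
Proof.
move=> eso ichi gchi.
have es2 := orthosystem_L2 eso.
pose w e y := inner_prod nu (gram_kernel y) e.
have w2 e : e \in Lfun nu 2%:E -> w e \in Lfun nu 2%:E.
  move=> e2; have k2 := kernel_op_L2 mG phi2 psi2 Gdom e2.
  have -> : w e = kernel_op mu (swapk G) (kernel_op nu G e).
    apply/funext => y; rewrite {1}/kernel_op inner_prodC (kernel_op_adjoint mG phi2 psi2 Gdom)//; last exact: tG.
    by rewrite inner_prodC.
  exact: kadjL2.
apply: (@le_trans _ _ (\sum_(e <- es) inner_prod nu (w e) (w e))).
  move: es2 eso; elim: es => [|e es IH] /=; first by rewrite !big_nil.
  move=> /andP[e2 es2] /orthosystem_cons[_ ee _ eso]; rewrite !big_cons.
  apply: lerD; last exact: IH.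
  rewrite inner_prod_kernel_op//; apply: (le_trans (inner_prod_cauchy_schwarz e2 (w2 _ e2))).
  by rewrite ler_piMl ?inner_prod_ge0//; move: ee; rewrite !inE => /orP[]/eqP->.
have intw : nu.-integrable setT (EFin \o (fun y => \sum_(e <- es) w e y * w e y)) /\
    \sum_(e <- es) inner_prod nu (w e) (w e) = \int[nu]_y (\sum_(e <- es) w e y * w e y).
  elim: (es) es2 => [|e es' IH] /=.
    move=> _; rewrite big_nil; split.
      by have := integrable0 nu setT; apply: eq_integrable => // y _ /=; rewrite big_nil.
    by rewrite /Rintegral integral0_eq// => y _; rewrite big_nil.
  move=> /andP[e2 es'2]; have [i1 i2] := IH es'2.
  have i3 := L2_mul_integrable (w2 _ e2) (w2 _ e2).
  split.
    have := integrableD measurableT i3 i1; apply: eq_integrable => // y _ /=.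
    by rewrite big_cons EFinD.
  by rewrite big_cons i2 /inner_prod -RintegralD//; apply: eq_Rintegral => y _; rewrite big_cons.
rewrite intw.2; apply: le_Rintegral => //; first exact: intw.1.
move=> y _; apply: le_trans (gchi y); apply: le_trans (bessel eso (gram_kernel_L2 y)).
by apply: ler_sum => e _; rewrite expr2.
Qed.

(** For each x, the error at x is at least the squared norm of the part of
G(x, .) orthogonal to the span of gs.  With an orthogonal system e_1, e_2, ...
of this span, integration in x shows that tau - E is at most the sum of the
squared norms of G e_k, to which the Cauchy-Schwarz inequality over k and
[sum_kernel_op_sqr] apply. *)
Theorem finite_rank_bound (chi : T -> R) (K : S * T -> R) (gs : seq (T -> R)) (E : R) :
  nu.-integrable setT (EFin \o chi) ->
  (forall y, inner_prod nu (gram_kernel y) (gram_kernel y) <= chi y) ->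
  measurable_fun setT K ->
  all (fun g => g \in Lfun nu 2%:E) gs ->
  (forall x, in_span gs (fun y => K (x, y))) ->
  (\int[mu \x nu]_z ((G z - K z) ^+ 2)%:E <= E%:E)%E ->
  let tau := \int[mu]_x inner_prod nu (fun y => G (x, y)) (fun y => G (x, y)) in
  E <= tau -> (tau - E) ^+ 2 <= (size gs)%:R * \int[nu]_y chi y.
Proof.
move=> ichi gchi mK gs2 Kspan dist tau Etau.
have [es [eso <- spanP]] := gram_schmidt gs2.
have es2 := orthosystem_L2 eso.
suff h : tau - E <= \sum_(e <- es) inner_prod mu (kernel_op nu G e) (kernel_op nu G e).
  apply: (@le_trans _ _ ((\sum_(e <- es) inner_prod mu (kernel_op nu G e) (kernel_op nu G e)) ^+ 2)).
    by rewrite lerXn2r ?nnegrE ?subr_ge0//; apply: le_trans h; rewrite subr_ge0.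
  apply: (le_trans (sqr_sum_le _ _)); rewrite ler_wpM2l//.
  exact: sum_kernel_op_sqr.
pose D x := inner_prod nu (fun y => G (x, y) - K (x, y)) (fun y => G (x, y) - K (x, y)).
pose t x := inner_prod nu (fun y => G (x, y)) (fun y => G (x, y)).
have KL2 x : (fun y => K (x, y)) \in Lfun nu 2%:E by exact: in_span_L2 (Kspan x).
have GKL2 x : (fun y => G (x, y) - K (x, y)) \in Lfun nu 2%:E.
  rewrite [X in X \in _](_ : _ = (fun y => G (x, y) - 1 * K (x, y))).
    exact: L2_subZ.
  by apply/funext => y; rewrite mul1r.
have mD : measurable_fun setT D.
  refine (measurable_Rintegral2 nu (f := fun z => (G z - K z) * (G z - K z)) _).
  by apply: measurable_funM; exact: measurable_funB.
have DE x : (\int[nu]_y ((G (x, y) - K (x, y)) ^+ 2)%:E = (D x)%:E)%E.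
  rewrite /D /inner_prod /Rintegral fineK.
    by apply: eq_integral => y _; rewrite expr2.
  exact: integrable_fin_num (L2_mul_integrable (GKL2 x) (GKL2 x)).
have DleE : (\int[mu]_x (D x)%:E <= E%:E)%E.
  apply: le_trans dist; rewrite fubini_tonelli1//=.
  - by rewrite le_eqVlt; apply/orP; left; apply/eqP; apply: eq_integral => x _; rewrite -(DE x).
  - by apply/measurable_EFinP; apply: measurable_funX; exact: measurable_funB.
  - by move=> z; rewrite lee_fin sqr_ge0.
have iD : mu.-integrable setT (EFin \o D).
  apply/integrableP; split; first exact/measurable_EFinP.
  apply: le_lt_trans (ltry E); apply: le_trans DleE.
  rewrite le_eqVlt; apply/orP; left; apply/eqP; apply: eq_integral => x _ /=.
  by rewrite ger0_norm// inner_prod_ge0.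
have it : mu.-integrable setT (EFin \o t) := kernel_sqr_integrable.
have ik : mu.-integrable setT (EFin \o (fun x => \sum_(e <- es) kernel_op nu G e x ^+ 2)) /\
    \int[mu]_x (\sum_(e <- es) kernel_op nu G e x ^+ 2) =
    \sum_(e <- es) inner_prod mu (kernel_op nu G e) (kernel_op nu G e).
  elim: (es) es2 => [|e es' IH] /=.
    move=> _; rewrite big_nil; split.
      by have := integrable0 mu setT; apply: eq_integrable => // y _ /=; rewrite big_nil.
    by rewrite /Rintegral integral0_eq// => y _; rewrite big_nil.
  move=> /andP[e2 es'2]; have [i1 i2] := IH es'2.
  have k2 := kernel_op_L2 mG phi2 psi2 Gdom e2.
  have i3 := L2_mul_integrable k2 k2.
  split.
    have := integrableD measurableT i3 i1; apply: eq_integrable => // y _ /=.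
    by rewrite big_cons EFinD expr2.
  rewrite big_cons -i2 /inner_prod -RintegralD//.
  by apply: eq_Rintegral => y _; rewrite big_cons expr2.
rewrite lerBlDr -lerBlDl -ik.2 /tau -RintegralB ?ik.1//.
rewrite -lee_fin; apply: le_trans DleE.
rewrite -[leRHS]fineK; last exact: integrable_fin_num iD.
rewrite lee_fin; apply: le_Rintegral => //.
  have := integrableB measurableT it ik.1; exact: eq_integrable.
by move=> x _; exact: dist_span eso (sG x) (spanP _ (Kspan x)).
Qed.

End FiniteRankBound.

(** * Borel measurability in three-dimensional space *)

(** The open sets are an argument because measurable types carry no topology;
this lets bases of two spaces be combined into one of their product. *)
Definition has_measurable_basis d (T : measurableType d) (open : set (set T)) :=
  exists (I : countType) (B : I -> set T), (forall i, measurable (B i)) /\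
    forall U x, open U -> U x -> exists2 i, B i x & B i `<=` U.

Lemma measurable_basis_open d (T : measurableType d) (open : set (set T)) U :
  has_measurable_basis open -> open U -> measurable U.
Proof.
move=> [I [B [mB basisB]]] oU.
have -> : U = \bigcup_i (if pselect (B i `<=` U) then B i else set0).
  apply/seteqP; split => x.
    by move=> Ux; have [i Bx BU] := basisB _ _ oU Ux; exists i => //; case: pselect.
  by move=> [i _]; case: pselect => // BU /BU.
apply: countable_bigcupT_measurable; first exact: countableP.
by move=> i; case: pselect => ?; [exact: mB|exact: measurable0].
Qed.

Lemma real_measurable_basis (R : realType) :
  has_measurable_basis (open : set (set (measurableTypeR R))).
Proof.
exists (rat * rat)%type, (fun q : rat * rat => [set` `]ratr q.1, ratr q.2[]); split.
  by move=> q; exact: measurable_itv.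
move=> U x; rewrite openE => /[apply] -[e /= e0 xeU].
have [p] : exists q, ratr q \in `]x - e, x[%R by apply: rat_in_itvoo; lra.
have [q] : exists q, ratr q \in `]x, x + e[%R by apply: rat_in_itvoo; lra.
rewrite !in_itv /= => /andP[xq qe] /andP[ep px].
exists (p, q); first by rewrite /= in_itv /= px.
move=> y /=; rewrite in_itv /= => /andP[py yq]; apply: xeU => /=.
by rewrite ltr_norml; apply/andP; split; lra.
Qed.

Lemma prod_measurable_basis d1 d2 (T1 : measurableType d1) (T2 : measurableType d2)
    (O1 : set (set T1)) (O2 : set (set T2)) (O : set (set (T1 * T2))) :
  (forall U z, O U -> U z -> exists A B,
    [/\ O1 A, O2 B, A z.1, B z.2 & A `*` B `<=` U]) ->
  has_measurable_basis O1 -> has_measurable_basis O2 -> has_measurable_basis O.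
Proof.
move=> rect [I1 [B1 [mB1 basis1]]] [I2 [B2 [mB2 basis2]]].
exists (I1 * I2)%type, (fun i => B1 i.1 `*` B2 i.2); split.
  by move=> i; exact: measurableX.
move=> U z OU Uz; have [A [B [OA OB Az Bz AB]]] := rect _ _ OU Uz.
have [i Bi BiA] := basis1 _ _ OA Az; have [j Bj BjB] := basis2 _ _ OB Bz.
exists (i, j); first by split.
by move=> y [/= y1 y2]; apply: AB; split; [exact: BiA|exact: BjB].
Qed.

Lemma open_prod_rect (S1 S2 : topologicalType) (U : set (S1 * S2)) z :
  open U -> U z -> exists A B, [/\ open A, open B, A z.1, B z.2 & A `*` B `<=` U].
Proof.
move=> oU Uz; have [[A B] [/= + +] AB] : nbhs z U by exact: open_nbhs_nbhs.
rewrite !nbhsE => -[A' [oA' A'z] A'A] [B' [oB' B'z] B'B].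
exists A', B'; split => // y [/= y1 y2]; apply: AB; split; [exact: A'A|exact: B'B].
Qed.

Section MeasurabilityR3.
Context {R : realType}.

Lemma R3_measurable_basis : has_measurable_basis (open : set (set (R3 R))).
Proof.
apply: prod_measurable_basis; [exact: open_prod_rect| |exact: real_measurable_basis].
by apply: prod_measurable_basis; [exact: open_prod_rect|exact: real_measurable_basis..].
Qed.

Lemma open_measurable3 (U : set (R3 R)) : open U -> measurable U.
Proof. exact: measurable_basis_open R3_measurable_basis. Qed.

Lemma compact_measurable3 (K : set (R3 R)) : compact K -> measurable K.
Proof.
move=> /compact_closed cK; rewrite -[K]setCK; apply: measurableC.
apply: open_measurable3; apply: closed_openC; apply: cK.
exact: norm_hausdorff.
Qed.

Lemma open_continuous_measurable_fun3 (D : set (R3 R)) (f : R3 R -> R) :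
  open D -> (forall x, D x -> {for x, continuous f}) -> measurable_fun D f.
Proof.
move=> oD cf; apply: (measurability _ (RGenOpens.measurableE R)).
move=> _ [_ [a [b ->] <-]]; apply: open_measurable3.
rewrite openE => x [Dx fx]; apply: filterI; first exact: open_nbhs_nbhs.
by apply: (cf x Dx); apply: open_nbhs_nbhs; split; [exact: interval_open|].
Qed.
End MeasurabilityR3.

Lemma measurable_sqrtr (R : realType) d (T : measurableType d) (f : T -> R) :
  measurable_fun setT f -> measurable_fun setT (fun x => Num.sqrt (f x)).
Proof.
by move=> mf; apply: measurableT_comp mf; apply: continuous_measurable_fun; exact: sqrt_continuous.
Qed.

Lemma measurable_invr (R : realType) d (T : measurableType d) (f : T -> R) :
  measurable_fun setT f -> (forall x, 0 <= f x) -> measurable_fun setT (fun x => (f x)^-1).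
Proof.
move=> mf f0; have -> : (fun x => (f x)^-1) = (fun x => f x `^ (-1)).
  by apply/funext => x; rewrite powR_inv1.
exact: measurableT_comp (measurable_powR _) mf.
Qed.

Lemma convex_set_segment (R : realType) (A : set (R3 R)) x y (s : R) :
  convex_set A -> A x -> A y -> 0 <= s <= 1 -> A (x + s *: (y - x)).
Proof.
move=> cA Ax Ay /andP[s0 s1].
have := cA y x (Itv01 s0 s1); rewrite !inE => /(_ Ay Ax).
congr A; rewrite -[LHS]/(s *: y + (1 - s) *: x).
by rewrite scalerBr scalerBl scale1r addrCA.
Qed.

(** * The attenuated zonal kernel *)

Section Kernel.
Context {R : realType}.
Implicit Types (x y u : R3 R).
Local Notation leb := (@lebesgue_measure R).

Definition hdist2 u : R := xcoord u ^+ 2 + ycoord u ^+ 2.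

Definition zonal_const n : R := (2 * n + 1)%:R / (4 * pi).

Lemma enormE u : enorm u = Num.sqrt (hdist2 u + zcoord u ^+ 2).
Proof. by []. Qed.

Lemma hdist2_ge0 u : 0 <= hdist2 u.
Proof. by rewrite addr_ge0 ?sqr_ge0. Qed.

Lemma zonal_const_gt0 n : 0 < zonal_const n.
Proof. by rewrite divr_gt0 ?ltr0n ?addn1// mulr_gt0// pi_gt0. Qed.

Lemma enorm_sqr u : enorm u ^+ 2 = hdist2 u + zcoord u ^+ 2.
Proof. by rewrite enormE sqr_sqrtr// addr_ge0 ?hdist2_ge0 ?sqr_ge0. Qed.

(** At u = 0 both sides vanish by the conventions on inverses. *)
Lemma cos_polar_angle u :
  cos (polar_angle ((enorm u)^-1 *: u)) = polar_cos (hdist2 u) (zcoord u).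
Proof.
have -> : polar_angle ((enorm u)^-1 *: u) = acos (polar_cos (hdist2 u) (zcoord u)).
  by congr acos; rewrite /polar_cos -enormE mulrC.
rewrite acosK// in_itv /= -ler_norml /polar_cos -enormE normrM normfV (@ger0_norm _ (enorm u)) ?sqrtr_ge0//.
have [e0|e0] := eqVneq (enorm u) 0; first by rewrite e0 invr0 mulr0.
have e1 : 0 < enorm u by rewrite lt_def e0 sqrtr_ge0.
rewrite ler_pdivrMr// mul1r -(@ler_pXn2r _ 2) ?nnegrE ?(ltW e1)//.
by rewrite real_normK ?num_real// enorm_sqr lerDr hdist2_ge0.
Qed.

Lemma Gn0E (sigma : R3 R -> R) n x y : Gn0 sigma n x y =
  attenuation sigma x y / enorm (x - y) ^+ 2 *
  (Num.sqrt (zonal_const n) * (legendre n).[polar_cos (hdist2 (x - y)) (zcoord (x - y))]).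
Proof. by rewrite /Gn0 /Yn0 cos_polar_angle. Qed.

Section Attenuation.
Variables (Omega : set (R3 R)) (sigma : R3 R -> R) (sigma0 sigma1 : R).
Hypotheses (Omega_dom : bounded_convex_domain Omega)
  (sigma_smooth : smooth_on Omega sigma) (sigma0_gt0 : 0 < sigma0)
  (sigma_bounds : forall x, Omega x -> sigma0 <= sigma x <= sigma1).

Let sigmaO := sigma \_ Omega.

Lemma measurable_sigma : measurable_fun setT sigmaO.
Proof.
have [oO _ _ _] := Omega_dom.
apply/(measurable_restrictT _ (open_measurable3 oO)).
by apply: open_continuous_measurable_fun3 => // x Ox; have [] := sigma_smooth [::] Ox.
Qed.

(** Extending sigma by 0 outside Omega turns the integral of sigma along a segment
into a function that is measurable on the whole space. *)
Definition optical_depth (z : R3 R * R3 R) : R :=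
  \int[leb]_s ((sigmaO (z.1 + s *: (z.2 - z.1))) * \1_`[0, 1] s).

Lemma optical_depthE x y : Omega x -> Omega y ->
  \int[leb]_(s in `[0, 1]) sigma (x + s *: (y - x)) = optical_depth (x, y).
Proof.
move=> Ox Oy; rewrite /optical_depth Rintegral_mkcond; apply: eq_Rintegral => s _.
rewrite patchE indicE; case: ifPn => [|_]; last by rewrite mulr0.
rewrite inE /= in_itv /= => s01; rewrite mulr1 /sigmaO patchE mem_set//.
by have [_ _ _ cO] := Omega_dom; exact: convex_set_segment.
Qed.

Lemma measurable_segment :
  measurable_fun setT (fun z : (R3 R * R3 R) * measurableTypeR R =>
    z.1.1 + (z.2 : R) *: (z.1.2 - z.1.1) : R3 R).
Proof.
have m11 : measurable_fun setT (fun z : (R3 R * R3 R) * measurableTypeR R => z.1.1).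
  by apply: measurableT_comp; [exact: measurable_fst|exact: measurable_fst].
have m12 : measurable_fun setT (fun z : (R3 R * R3 R) * measurableTypeR R => z.1.2).
  by apply: measurableT_comp; [exact: measurable_snd|exact: measurable_fst].
have seg (p : R3 R -> measurableTypeR R) : measurable_fun setT p ->
    measurable_fun setT (fun z : (R3 R * R3 R) * measurableTypeR R =>
      (p z.1.1 : R) + (z.2 : R) * ((p z.1.2 : R) - p z.1.1)).
  move=> mp; have mp1 := measurableT_comp mp m11; have mp2 := measurableT_comp mp m12.
  by apply: measurable_funD => //; apply: measurable_funM => //; apply: measurable_funB.
apply: measurable_fun_pair; first apply: measurable_fun_pair.
- apply: (seg (fun x : R3 R => x.1.1)); apply: measurableT_comp; exact: measurable_fst.
- apply: (seg (fun x : R3 R => x.1.2)); apply: measurableT_comp; [exact: measurable_snd|exact: measurable_fst].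
- by apply: (seg (fun x : R3 R => x.2)); exact: measurable_snd.
Qed.

Lemma measurable_optical_depth : measurable_fun setT optical_depth.
Proof.
refine (measurable_Rintegral2 leb
  (f := fun z : (R3 R * R3 R) * measurableTypeR R => sigmaO (z.1.1 + z.2 *: (z.1.2 - z.1.1)) * \1_`[0, 1] z.2) _).
apply: measurable_funM.
  exact: measurableT_comp measurable_sigma measurable_segment.
by apply: measurableT_comp => //; exact: measurable_indic.
Qed.

Lemma optical_depth_bounds x y : Omega x -> Omega y ->
  0 <= optical_depth (x, y) <= sigma1.
Proof.
move=> Ox Oy; have [_ _ _ cO] := Omega_dom.
have inO s : s \in `[0, 1] -> Omega (x + s *: (y - x)).
  by rewrite in_itv /= => s01; exact: convex_set_segment.
apply/andP; split.
  rewrite -optical_depthE//; apply: Rintegral_ge0 => s s01.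
  by have /andP[h _] := sigma_bounds (inO _ s01); apply: le_trans h; exact: ltW.
rewrite -[leRHS]mulr1.
have -> : sigma1 * 1 = \int[leb]_(s in `[0, 1]) sigma1.
  by rewrite Rintegral_cst//= lebesgue_measure_itv /= lte01 sube0.
rewrite -optical_depthE//.
have mS : measurable_fun (`[0, 1] : set (measurableTypeR R)) (fun s : R => sigma (x + s *: (y - x))).
  have m1 : measurable_fun (`[0, 1] : set (measurableTypeR R)) (fun s : R => sigmaO (x + s *: (y - x))).
    apply: measurable_funTS.
    apply: (measurableT_comp measurable_sigma).
    exact: measurableT_comp measurable_segment (pair1_measurable (x, y)).
  apply: eq_measurable_fun m1 => s; rewrite inE /= => s01.
  by rewrite /sigmaO patchE mem_set//; exact: inO.
have icst : leb.-integrable `[0, 1] (EFin \o cst sigma1).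
  by apply: continuous_compact_integrable; [exact: segment_compact|exact: cst_continuous].
apply: le_Rintegral => //.
  apply: (le_integrable _ _ _ icst) => //; first exact/measurable_EFinP.
  move=> s s01; have /andP[h1 h2] := sigma_bounds (inO _ s01).
  have s0 : 0 <= sigma (x + s *: (y - x)) by apply: le_trans h1; exact: ltW.
  by rewrite /= lee_fin !ger0_norm//; exact: le_trans h2.
by move=> s s01; have /andP[] := sigma_bounds (inO _ s01).
Qed.

Lemma attenuation_bounds x y : Omega x -> Omega y ->
  expR (- enorm (x - y) * sigma1) <= attenuation sigma x y <= 1.
Proof.
move=> Ox Oy; have /andP[h0 h1] := optical_depth_bounds Ox Oy.
have e0 : 0 <= enorm (x - y) by exact: sqrtr_ge0.
rewrite /attenuation optical_depthE// ler_expR !mulNr lerN2 ler_wpM2l//=.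
by rewrite -expR0 ler_expR oppr_le0 mulr_ge0.
Qed.

End Attenuation.
End Kernel.

(** * A dyadic majorant of an integrable singularity *)

Lemma ltr_powRr (R : realType) (a x y : R) : 1 < a -> x < y -> a `^ x < a `^ y.
Proof.
move=> a1 xy; have a0 : a != 0 by rewrite gt_eqF// (lt_trans _ a1).
by rewrite /powR (negbTE a0) ltr_expR ltr_pM2r// ln_gt0.
Qed.

Lemma bernoulli_le (R : realDomainType) (b : R) n : 1 <= b -> 1 + (b - 1) * n%:R <= b ^+ n.
Proof.
move=> b1; elim: n => [|n IH]; first by rewrite mulr0 addr0.
have := ler_wpM2l (le_trans ler01 b1) IH; rewrite -exprS; apply: le_trans.
rewrite -natr1; have : 0 <= (b - 1) ^+ 2 * n%:R by rewrite mulr_ge0// sqr_ge0.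
by rewrite expr2; lra.
Qed.

Section DyadicMajorant.
Context {R : realType}.
Implicit Types (y v : R3 R).
Variables (L gamma : R).
Hypotheses (L0 : 0 < L) (gamma0 : 0 < gamma) (gamma3 : gamma < 3).

Definition closed_cube y (e : R) : set (R3 R) :=
  (`[y.1.1 - e, y.1.1 + e] `*` `[y.1.2 - e, y.1.2 + e]) `*` `[y.2 - e, y.2 + e].

Lemma closed_cubeP y v e : closed_cube y e v <-> `|y - v| <= e.
Proof.
rewrite !prod_normE !ge_max /=; split.
  move=> [[/= +] + +]; rewrite !in_itv /= => /andP[h1 h2] /andP[h3 h4] /andP[h5 h6].
  by apply/andP; split; [apply/andP; split|]; rewrite ler_norml; apply/andP; split; lra.
move=> /andP[/andP[]]; rewrite !ler_norml => /andP[h1 h2] /andP[h3 h4] /andP[h5 h6].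
by split; [split|] => /=; rewrite in_itv /=; apply/andP; split; lra.
Qed.

Lemma measurable_cube y e : measurable (closed_cube y e).
Proof. by apply: measurableX; [apply: measurableX|]; exact: measurable_itv. Qed.

Lemma lebesgue3X (A B C : set (measurableTypeR R)) :
  measurable A -> measurable B -> measurable C ->
  lebesgue3 ((A `*` B) `*` C) =
  (lebesgue_measure A * lebesgue_measure B * lebesgue_measure C)%E.
Proof.
move=> mA mB mC; rewrite /lebesgue3 product_measure1E//; last exact: measurableX.
by rewrite /= /lebesgue2 product_measure1E.
Qed.

Lemma lebesgue3_cube y e : 0 < e -> lebesgue3 (closed_cube y e) = ((2 * e) ^+ 3)%:E.
Proof.
move=> e0; rewrite /closed_cube lebesgue3X; try exact: measurable_itv.
rewrite !lebesgue_measure_itv /= !lte_fin.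
have h (a : R) : (a - e < a + e) by lra.
have E (a : R) : a + e - (a - e) = 2 * e by ring.
by rewrite !h -!EFinD !E -!EFinM; congr (_%:E); ring.
Qed.

Let b := 2 `^ gamma.

Let b_gt1 : 1 < b.
Proof. by rewrite /b -[X in X < _](powRr0 2) ltr_powRr// ltr1n. Qed.

Let b_lt8 : b / 8 < 1.
Proof.
rewrite ltr_pdivrMr ?mul1r ?ltr0n//.
have -> : 8 = 2 `^ 3 :> R by rewrite powR_mulrn// -natrX.
by rewrite ltr_powRr// ltr1n.
Qed.

(** A substitute for (|v| / L)^(- gamma) whose integral is elementary: a weighted
sum of indicators of cubes.  It is infinite at v = 0, so that the diagonal
needs no separate treatment. *)
Definition dyadic_majorant v : \bar R :=
  (\sum_(k <oo) (b ^+ k.+1 * (`|v| <= L / 2 ^+ k)%R%:R)%:E)%E.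

Lemma dyadic_majorant_ge v (c : R) k :
  `|v| <= L / 2 ^+ k -> c <= b ^+ k.+1 -> (c%:E <= dyadic_majorant v)%E.
Proof.
move=> vk cb; apply: (@le_trans _ _ (b ^+ k.+1 * (`|v| <= L / 2 ^+ k)%R%:R)%:E).
  by rewrite vk mulr1 lee_fin.
apply: le_trans (nneseries_lim_ge k.+1 _); last first.
  by move=> j _ _; rewrite lee_fin mulr_ge0// exprn_ge0// ltW// (lt_trans _ b_gt1).
rewrite big_nat_recr//= leeDr// sume_ge0// => j _.
by rewrite lee_fin mulr_ge0// exprn_ge0// ltW// (lt_trans _ b_gt1).
Qed.

(** One term of the series suffices: that of the smallest dyadic cube containing v
if v is not 0, and a term of large weight otherwise. *)
Lemma le_dyadic_majorant v (c : R) : `|v| <= L ->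
  (v != 0 -> c <= (`|v| / L) `^ (- gamma)) -> (c%:E <= dyadic_majorant v)%E.
Proof.
move=> vL cv; have [v0|v0] := eqVneq v 0.
  have [k ck] : exists k : nat, c <= b ^+ k.+1.
    have c1 : 0 < b - 1 by rewrite subr_gt0.
    have [k ck] : exists k : nat, c <= 1 + (b - 1) * k%:R.
      exists (Num.truncn (`|c| / (b - 1))).+1.
      have := truncnS_gt (`|c| / (b - 1)).
      rewrite ltr_pdivrMr// => h; have := ler_norm c; lra.
    exists k; apply: (le_trans ck); apply: (le_trans (bernoulli_le k (ltW b_gt1))).
    by rewrite exprS ler_peMl ?exprn_ge0 ?ltW// (lt_trans _ b_gt1).
  by apply: (dyadic_majorant_ge (k := k)) => //; rewrite v0 normr0 divr_ge0 ?exprn_ge0// ltW.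
have nv : 0 < `|v| by rewrite normr_gt0.
have ex : exists k : nat, L / 2 ^+ k.+1 < `|v|.
  exists (Num.truncn (L / `|v|)); rewrite ltr_pdivrMr ?exprn_gt0// mulrC -ltr_pdivrMr//.
  apply: (lt_le_trans (truncnS_gt _)).
  by rewrite -natrX ler_nat ltnW// ltn_expl.
case: (ex_minnP ex) => k hk kmin.
apply: (dyadic_majorant_ge (k := k)).
  case: k hk kmin => [|k] hk kmin; first by rewrite expr0 divr1.
  by rewrite leNgt; apply/negP => /kmin; rewrite ltnn.
apply: (le_trans (cv v0)).
have q0 : 0 < `|v| / L by rewrite divr_gt0.
have bE : b ^+ k.+1 = (2 ^+ k.+1) `^ gamma.
  by rewrite /b -powR_mulrn ?powR_ge0// -powRrM mulrC powRrM powR_mulrn.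
rewrite powRN -div1r ler_pdivrMr ?powR_gt0// bE -powRM ?exprn_ge0 ?(ltW q0)//.
have one : 1 = 1 `^ gamma :> R by rewrite powR1.
rewrite [X in X <= _]one ge0_ler_powR ?ltW// ?nnegrE//.
  by rewrite mulr_ge0// ltW.
by rewrite mulrA ltr_pdivlMr// mul1r mulrC -ltr_pdivrMr ?exprn_gt0.
Qed.

Lemma dyadic_majorant_ge0 v : (0 <= dyadic_majorant v)%E.
Proof.
apply: nneseries_ge0 => k _ _.
by rewrite lee_fin mulr_ge0// exprn_ge0// ltW// (lt_trans _ b_gt1).
Qed.

Definition dyadic_mass : R := 8 * L ^+ 3 * b / (1 - b / 8).

Lemma dyadic_mass_gt0 : 0 < dyadic_mass.
Proof.
by rewrite divr_gt0 ?subr_gt0// !mulr_gt0 ?exprn_gt0// (lt_trans _ b_gt1).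
Qed.

Let term_cube y k v : (b ^+ k.+1 * (`|y - v| <= L / 2 ^+ k)%R%:R)%:E =
  ((b ^+ k.+1)%:E * (\1_(closed_cube y (L / 2 ^+ k)) v)%:E)%E.
Proof.
rewrite -EFinM indicE; congr (_ * _%:R)%:E; congr nat_of_bool.
by apply/idP/idP; rewrite inE closed_cubeP.
Qed.

Lemma measurable_dyadic_majorant y :
  measurable_fun setT (fun v => dyadic_majorant (y - v)).
Proof.
rewrite /dyadic_majorant; apply: ge0_emeasurable_sum.
  by move=> k v _ _; rewrite lee_fin mulr_ge0// exprn_ge0// ltW// (lt_trans _ b_gt1).
move=> k _; under eq_fun do rewrite term_cube.
apply: emeasurable_funM => //; apply/measurable_EFinP; apply: measurable_indic.
exact: measurable_cube.
Qed.

(** The cube of index k has volume (2 L / 2^k)^3 and weight 2^(gamma (k + 1)), so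
the integrals form a geometric series of ratio 2^gamma / 8, and gamma < 3. *)
Lemma integral_dyadic_majorant y :
  (\int[lebesgue3]_v dyadic_majorant (y - v)%R <= dyadic_mass%:E)%E.
Proof.
have b0 k : 0 <= b ^+ k by rewrite exprn_ge0// ltW// (lt_trans _ b_gt1).
rewrite integral_nneseries//; last 2 first.
- move=> k; under eq_fun do rewrite term_cube.
  apply: emeasurable_funM => //; apply/measurable_EFinP; apply: measurable_indic.
  exact: measurable_cube.
- by move=> k v _; rewrite lee_fin mulr_ge0.
have E k : (\int[lebesgue3]_v (b ^+ k.+1 * (`|(y - v)%R| <= L / 2 ^+ k)%R%:R)%:E =
    (geometric (8 * L ^+ 3 * b) (b / 8) k)%:E)%E.
  under eq_integral do rewrite term_cube.
  rewrite ge0_integralZl_EFin//; last first.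
    by apply/measurable_EFinP; apply: measurable_indic; exact: measurable_cube.
  rewrite integral_indic//; last exact: measurable_cube.
  rewrite setIT /= lebesgue3_cube ?divr_gt0 ?exprn_gt0// -EFinM /geometric /=; congr (_%:E).
  have t0 : 2 ^+ k != 0 :> R by rewrite expf_neq0.
  have -> : 8 = 2 ^+ 3 :> R by rewrite -natrX.
  by rewrite expr_div_n exprS exprAC; field.
under eq_eseriesr do rewrite E.
apply: lime_le.
  by apply: is_cvg_nneseries => k _ _;
    rewrite lee_fin /geometric /= mulr_ge0 ?exprn_ge0 ?divr_ge0 ?mulr_ge0 ?exprn_ge0 ?ltW//
      (lt_trans _ b_gt1).
near=> m; rewrite sumEFin lee_fin.
have h := @geometric_le_lim R m (8 * L ^+ 3 * b) (b / 8).
apply: h.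
- by rewrite !mulr_ge0 ?exprn_ge0 ?ltW// (lt_trans _ b_gt1).
- by rewrite divr_gt0// (lt_trans _ b_gt1).
- by rewrite ger0_norm// divr_ge0 ?ltW// (lt_trans _ b_gt1).
Unshelve. all: by end_near. Qed.

End DyadicMajorant.

(** * Separated compact sets *)

Section Geometry.
Context {R : realType}.
Implicit Types (x y u : R3 R) (X Y K : set (R3 R)).

Lemma continuous_coord (p : R3 R -> R) : continuous p ->
  continuous (fun z : R3 R * R3 R => p z.1 - p z.2).
Proof.
move=> cp z; apply: cvgB.
  by apply: (@continuous_comp _ _ _ fst p); [exact: cvg_fst|exact: cp].
by apply: (@continuous_comp _ _ _ snd p); [exact: cvg_snd|exact: cp].
Qed.

Lemma continuous_xcoord : continuous (@xcoord R).
Proof. by move=> x; apply: (@continuous_comp _ _ _ fst fst); exact: cvg_fst. Qed.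

Lemma continuous_ycoord : continuous (@ycoord R).
Proof. by move=> x; apply: (@continuous_comp _ _ _ fst snd); [exact: cvg_fst|exact: cvg_snd]. Qed.

Lemma continuous_zcoord : continuous (@zcoord R).
Proof. by move=> x; exact: cvg_snd. Qed.

Lemma continuous_sqr (T : topologicalType) (f : T -> R) : continuous f ->
  continuous (fun z => f z ^+ 2).
Proof. by move=> cf z; rewrite [X in continuous_at _ X](_ : _ = (fun z => f z * f z))//; apply: cvgM; exact: cf. Qed.

Lemma continuous_hdist2 : continuous (fun z : R3 R * R3 R => hdist2 (z.1 - z.2)).
Proof.
have h1 := continuous_sqr (continuous_coord continuous_xcoord).
have h2 := continuous_sqr (continuous_coord continuous_ycoord).
by move=> z; apply: cvgD; [exact: h1|exact: h2].
Qed.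

Lemma compact_gt0_bound (T : topologicalType) (K : set T) (f : T -> R) :
  compact K -> continuous f -> (forall z, K z -> 0 < f z) ->
  exists2 m, 0 < m & forall z, K z -> m <= f z.
Proof.
move=> cK cf f0.
have cfK : compact (f @` K).
  by apply: continuous_compact => //; exact: continuous_subspaceT.
have /compact_closed clK := cfK.
have {}clK := clK (@Rhausdorff R).
have [e /= e0 he] : nbhs 0 (~` (f @` K)).
  apply: open_nbhs_nbhs; split; first exact: closed_openC.
  by move=> [z Kz fz]; have := f0 _ Kz; rewrite fz ltxx.
exists e => // z Kz; rewrite leNgt; apply/negP => fe.
apply: (he (f z)); last by exists z.
by rewrite /= sub0r normrN ger0_norm// ltW// f0.
Qed.

Lemma compact_le_bound (T : topologicalType) (K : set T) (f : T -> R) :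
  compact K -> continuous f -> exists2 M, 0 < M & forall z, K z -> f z <= M.
Proof.
move=> cK cf.
have cfK : compact (f @` K).
  by apply: continuous_compact => //; exact: continuous_subspaceT.
have [M [_ hM]] := compact_bounded cfK.
exists (`|M| + 1); first by rewrite ltr_wpDl.
move=> z Kz; apply: (le_trans (ler_norm _)); apply: (hM (`|M| + 1)); last by exists z.
by rewrite (le_lt_trans (ler_norm M))// ltrDl.
Qed.

(** The gap keeps the directions x - y away from the z-axis, where the zonal
harmonics of high degree concentrate. *)
Lemma horizontal_gap X Y : compact X -> compact Y ->
  (xyproj @` X) `&` (xyproj @` Y) = set0 ->
  exists2 rho, 0 < rho & forall x y, X x -> Y y -> rho <= hdist2 (x - y).
Proof.
move=> cX cY disj.
have [|rho rho0 h] := compact_gt0_bound (compact_setX cX cY) continuous_hdist2.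
  move=> [x y] [/= Xx Yy]; rewrite lt_def hdist2_ge0 andbT; apply/negP => /eqP h0.
  move/eqP: h0; rewrite /hdist2 paddr_eq0 ?sqr_ge0// !sqrf_eq0.
  move=> /andP[/eqP hx /eqP hy].
  have : ((xyproj @` X) `&` (xyproj @` Y)) (xyproj x).
    split; first by exists x.
    exists y => //; apply/esym; congr pair.
      by apply/eqP; rewrite -subr_eq0; apply/eqP.
    by apply/eqP; rewrite -subr_eq0; apply/eqP.
  by rewrite disj.
by exists rho => // x y Xx Yy; exact: (h (x, y)).
Qed.

Lemma diameter_bound X Y : compact X -> compact Y ->
  exists2 D, 0 < D & forall x y, X x -> Y y -> hdist2 (x - y) + zcoord (x - y) ^+ 2 <= D ^+ 2.
Proof.
move=> cX cY.
have cz := continuous_sqr (continuous_coord continuous_zcoord).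
have cd : continuous (fun z : R3 R * R3 R => hdist2 (z.1 - z.2) + zcoord (z.1 - z.2) ^+ 2).
  by move=> z; apply: cvgD; [exact: continuous_hdist2|exact: cz].
have [M M0 h] := compact_le_bound (compact_setX cX cY) cd.
exists (1 + M); first by rewrite addr_gt0.
move=> x y Xx Yy; apply: (le_trans (h (x, y) _)); first by split.
by rewrite expr2; nra.
Qed.

Lemma interior_cube K : K° !=set0 -> exists x e, 0 < e /\ closed_cube x e `<=` K.
Proof.
move=> [x]; rewrite /interior => /nbhs_ballP[e /= e0 he]; exists x, (e / 2); split; first by rewrite divr_gt0.
move=> y; rewrite closed_cubeP => h; apply: he.
by rewrite prod_norm_ball /ball_ /=; apply: (le_lt_trans h); rewrite ltr_pdivrMr// ltr_pMr// ltr1n.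
Qed.

Lemma lebesgue3_compact_fin K : compact K -> (lebesgue3 K < +oo)%E.
Proof.
move=> cK; have [M [_ hM]] := compact_bounded cK.
pose e := `|M| + 1; have e0 : 0 < e by rewrite ltr_wpDl.
have sub : K `<=` closed_cube 0 e.
  move=> x Kx; rewrite closed_cubeP sub0r normrN; apply: (hM e) => //.
  by rewrite (le_lt_trans (ler_norm M))// ltrDl.
apply: (@le_lt_trans _ _ (lebesgue3 (closed_cube 0 e))).
  by apply: le_measure => //; rewrite inE; [exact: compact_measurable3|exact: measurable_cube].
by rewrite lebesgue3_cube// ltry.
Qed.

Lemma lebesgue3_gt0 K : compact K -> K° !=set0 -> (0 < lebesgue3 K)%E.
Proof.
move=> cK /interior_cube[x [e [e0 sub]]].
apply: (@lt_le_trans _ _ (lebesgue3 (closed_cube x e))).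
  by rewrite lebesgue3_cube// lte_fin exprn_gt0// mulr_gt0.
by apply: le_measure => //; rewrite inE; [exact: measurable_cube|exact: compact_measurable3].
Qed.

End Geometry.

(** * Size of the kernel *)

Section KernelMeasurability.
Context {R : realType}.
Local Notation RR3 := (R3 R * R3 R)%type.

Lemma measurable_coord_diff (p : R3 R -> measurableTypeR R) : measurable_fun setT p ->
  measurable_fun setT (fun z : RR3 => (p z.1 : R) - p z.2).
Proof.
move=> mp; apply: measurable_funB.
  exact: measurableT_comp mp measurable_fst.
exact: measurableT_comp mp measurable_snd.
Qed.

Lemma measurable_hdist2 : measurable_fun setT (fun z : RR3 => hdist2 (z.1 - z.2)).
Proof.
apply: measurable_funD; apply: measurable_funX.
  apply: (measurable_coord_diff (p := fun x : R3 R => x.1.1)).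
  by apply: measurableT_comp; exact: measurable_fst.
apply: (measurable_coord_diff (p := fun x : R3 R => x.1.2)).
by apply: measurableT_comp; [exact: measurable_snd|exact: measurable_fst].
Qed.

Lemma measurable_zdiff : measurable_fun setT (fun z : RR3 => zcoord (z.1 - z.2)).
Proof.
apply: (measurable_coord_diff (p := fun x : R3 R => x.2)); exact: measurable_snd.
Qed.

Lemma measurable_enorm : measurable_fun setT (fun z : RR3 => enorm (z.1 - z.2)).
Proof.
apply: measurable_sqrtr; apply: measurable_funD; first exact: measurable_hdist2.
by apply: measurable_funX; exact: measurable_zdiff.
Qed.

Lemma measurable_enormV : measurable_fun setT (fun z : RR3 => (enorm (z.1 - z.2))^-1).
Proof. by apply: measurable_invr measurable_enorm _ => z; exact: sqrtr_ge0. Qed.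

Lemma measurable_polar_cos :
  measurable_fun setT (fun z : RR3 => polar_cos (hdist2 (z.1 - z.2)) (zcoord (z.1 - z.2))).
Proof. exact: measurable_funM measurable_zdiff measurable_enormV. Qed.

Lemma measurable_legendre_polar_cos n : measurable_fun setT
  (fun z : RR3 => (legendre n).[polar_cos (hdist2 (z.1 - z.2)) (zcoord (z.1 - z.2))]).
Proof.
apply: (@measurableT_comp _ _ _ _ _ _ (horner (legendre n))); first exact: measurable_poly.
exact: measurable_polar_cos.
Qed.

End KernelMeasurability.

Section KernelEstimates.
Context {R : realType}.
Variables (Omega : set (R3 R)) (sigma : R3 R -> R) (sigma0 sigma1 : R).
Hypotheses (Omega_dom : bounded_convex_domain Omega)
  (sigma_smooth : smooth_on Omega sigma) (sigma0_gt0 : 0 < sigma0)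
  (sigma_bounds : forall x, Omega x -> sigma0 <= sigma x <= sigma1).
Variables (X Y : set (R3 R)).
Hypotheses (cX : compact X) (cY : compact Y) (XOmega : X `<=` Omega) (YOmega : Y `<=` Omega).
Variables (rho D : R).
Hypotheses (rho0 : 0 < rho) (D0 : 0 < D)
  (gap : forall x y, X x -> Y y -> rho <= hdist2 (x - y))
  (diam : forall x y, X x -> Y y -> hdist2 (x - y) + zcoord (x - y) ^+ 2 <= D ^+ 2).
Variable n : nat.
Hypothesis n0 : (0 < n)%N.
Implicit Types x y : R3 R.

Let lam0 : 0 < legendre_eigenvalue n :> R. Proof. by rewrite /legendre_eigenvalue mulr_gt0// ltr0n. Qed.

(** The order of magnitude of the squared kernel as a function of n; the value of
the energy at 0 that it contains cancels in the final estimate. *)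
Definition kernel_scale : R := zonal_const n * ((sonin n).[0] / legendre_eigenvalue n).

Lemma kernel_scale_gt0 : 0 < kernel_scale.
Proof. by rewrite mulr_gt0 ?zonal_const_gt0// divr_gt0// sonin0_gt0. Qed.

Definition restricted_kernel : R3 R * R3 R -> R :=
  (fun z => Gn0 sigma n z.1 z.2) \_ (X `*` Y).

Lemma restricted_kernelE x y : X x -> Y y -> restricted_kernel (x, y) = Gn0 sigma n x y.
Proof. by move=> Xx Yy; rewrite /restricted_kernel patchE mem_set. Qed.

Lemma measurable_restricted_kernel : measurable_fun setT restricted_kernel.
Proof.
have mXY : measurable (X `*` Y) by apply: measurableX; exact: compact_measurable3.
pose g (z : R3 R * R3 R) := expR (- enorm (z.1 - z.2) * optical_depth Omega sigma z) *
  ((enorm (z.1 - z.2))^-1) ^+ 2 * (Num.sqrt (zonal_const n) *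
  (legendre n).[polar_cos (hdist2 (z.1 - z.2)) (zcoord (z.1 - z.2))]).
have -> : restricted_kernel = g \_ (X `*` Y).
  apply/funext => -[x y]; rewrite /restricted_kernel !patchE; case: ifPn => // /[!inE] -[/= Xx Yy].
  rewrite Gn0E /g /= /attenuation (optical_depthE sigma Omega_dom) ?exprVn//.
  - exact: XOmega.
  - exact: YOmega.
apply/(measurable_restrictT _ mXY); apply: measurable_funTS.
apply: measurable_funM; first apply: measurable_funM.
- apply: measurableT_comp; first exact: measurable_expR.
  apply: measurable_funM; last exact: measurable_optical_depth Omega_dom sigma_smooth.
  by apply: measurableT_comp => //; exact: measurable_enorm.
- by apply: measurable_funX; exact: measurable_enormV.
- by apply: measurable_funM => //; exact: measurable_legendre_polar_cos.
Qed.

(** The squared sine of the polar angle is at least rho / D^2, which makes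
[legendre_sqr_le] a bound on P_n^2. *)
Lemma Gn0_sqr_le x y : X x -> Y y ->
  Gn0 sigma n x y ^+ 2 <= D ^+ 2 / rho ^+ 3 * kernel_scale.
Proof.
move=> Xx Yy; rewrite Gn0E.
have /andP[a0 a1] := attenuation_bounds Omega_dom sigma_smooth sigma0_gt0 sigma_bounds (XOmega Xx) (YOmega Yy).
have r0 := gap Xx Yy; have hd := diam Xx Yy.
set a := attenuation _ _ _ in a0 a1 *; set r := hdist2 _ in r0 hd *.
set z := zcoord _ in hd *.
have {}a0 : 0 <= a by apply: le_trans a0; exact: expR_ge0.
have rgt0 : 0 < r by apply: lt_le_trans r0.
have q0 : 0 < r + z ^+ 2 by rewrite ltr_wpDr// sqr_ge0.
have t1 : 1 - polar_cos r z ^+ 2 = r / (r + z ^+ 2) by exact: polar_cos_sqr.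
have S0 : 0 < (sonin n).[0] / legendre_eigenvalue n :> R by rewrite divr_gt0 ?sonin0_gt0.
have qr : (r + z ^+ 2) / r <= D ^+ 2 / rho.
  apply: ler_pM => //; [exact: ltW|by rewrite invr_ge0 ltW|].
  by rewrite lef_pV2 ?posrE.
have P2 : (legendre n).[polar_cos r z] ^+ 2 <= (sonin n).[0] / legendre_eigenvalue n * (D ^+ 2 / rho).
  have t2 : polar_cos r z ^+ 2 <= 1 by rewrite -subr_ge0 t1 divr_ge0// ltW.
  have := legendre_sqr_le n t2; rewrite t1 => h.
  apply: (@le_trans _ _ ((sonin n).[0] / legendre_eigenvalue n * ((r + z ^+ 2) / r))); last first.
    by rewrite ler_pM2l.
  set p := _.[polar_cos r z] in h *; set S := _.[0] in h *.
  have -> : p ^+ 2 = (r / (r + z ^+ 2) * (legendre_eigenvalue n * p ^+ 2)) * ((legendre_eigenvalue n)^-1 * ((r + z ^+ 2) / r)).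
    by field; rewrite !gt_eqF.
  by rewrite -[leRHS]mulrA; apply: ler_wpM2r => //; rewrite mulr_ge0 ?invr_ge0 ?divr_ge0// ltW.
rewrite !exprMn exprVn enorm_sqr -/r -/z sqr_sqrtr ?(ltW (zonal_const_gt0 n))//.
set p2 := _ ^+ 2 in P2 *.
have -> : D ^+ 2 / rho ^+ 3 * kernel_scale =
    (1 * (rho ^- 1) ^+ 2) * (zonal_const n * ((sonin n).[0] / legendre_eigenvalue n * (D ^+ 2 / rho))).
  by rewrite /kernel_scale; field; rewrite !gt_eqF.
apply: ler_pM.
- by rewrite mulr_ge0 ?sqr_ge0// invr_ge0 sqr_ge0.
- by rewrite mulr_ge0 ?sqr_ge0// ltW// zonal_const_gt0.
- apply: ler_pM; rewrite ?sqr_ge0 ?invr_ge0 ?sqr_ge0//; first by rewrite expr_le1.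
  rewrite exprVn lef_pV2 ?posrE ?exprn_gt0// lerXn2r ?nnegrE ?(ltW rho0) ?(ltW q0)//.
  by apply: (le_trans r0); rewrite lerDl sqr_ge0.
- by rewrite ler_pM2l// zonal_const_gt0.
Qed.

Lemma restricted_kernel_dom x y :
  `|restricted_kernel (x, y)| <= `|(Num.sqrt (D ^+ 2 / rho ^+ 3 * kernel_scale) * \1_X x) * \1_Y y|.
Proof.
rewrite /restricted_kernel patchE; case: ifPn => [|_]; last by rewrite normr0.
rewrite inE => -[/= Xx Yy]; rewrite !indicE !mem_set// !mulr1.
rewrite [leRHS]ger0_norm ?sqrtr_ge0// -sqrtr_sqr ler_sqrt ?Gn0_sqr_le//.
by rewrite mulr_ge0 ?divr_ge0 ?exprn_ge0 ?ltW// kernel_scale_gt0.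
Qed.

Definition kernel_floor : R := (expR (- D * sigma1) / D ^+ 2) ^+ 2.

Lemma Gn0_sqr_ge x y : X x -> Y y ->
  kernel_floor * (zonal_const n *
    (legendre n).[polar_cos (hdist2 (x - y)) (zcoord (x - y))] ^+ 2) <=
  Gn0 sigma n x y ^+ 2.
Proof.
move=> Xx Yy; rewrite Gn0E.
have /andP[a0 a1] := attenuation_bounds Omega_dom sigma_smooth sigma0_gt0 sigma_bounds (XOmega Xx) (YOmega Yy).
have r0 := gap Xx Yy; have := diam Xx Yy; rewrite -enorm_sqr => hd.
have s1 : 0 <= sigma1.
  have /andP[h1 h2] := sigma_bounds (XOmega Xx).
  exact: le_trans (ltW sigma0_gt0) (le_trans h1 h2).
have e0 : 0 < enorm (x - y) ^+ 2.
  rewrite enorm_sqr; apply: ltr_pwDl; last exact: sqr_ge0.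
  exact: lt_le_trans r0.
have eD : enorm (x - y) <= D.
  by rewrite -(@ler_pXn2r _ 2) ?nnegrE ?(ltW D0) ?sqrtr_ge0.
have a2 : expR (- D * sigma1) <= attenuation sigma x y.
  apply: le_trans a0; rewrite ler_expR !mulNr lerN2.
  by rewrite ler_wpM2r.
rewrite [leRHS]exprMn [X in _ <= _ * X]exprMn (@sqr_sqrtr _ (zonal_const n)) ?(ltW (zonal_const_gt0 n))//.
apply: ler_wpM2r; first by rewrite mulr_ge0 ?sqr_ge0// ltW// zonal_const_gt0.
rewrite /kernel_floor lerXn2r ?nnegrE//.
- by rewrite divr_ge0 ?expR_ge0 ?sqr_ge0.
- by rewrite divr_ge0 ?sqr_ge0//; apply: le_trans a2; exact: expR_ge0.
apply: ler_pM => //; rewrite ?expR_ge0 ?invr_ge0 ?sqr_ge0//.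
by rewrite lef_pV2 ?posrE ?(exprn_gt0 _ D0)// lerXn2r ?nnegrE ?sqrtr_ge0 ?(ltW D0)//.
Qed.

Section LowerBound.
Variables (y0 : R3 R) (e : R).
Hypotheses (e0 : 0 < e) (cubeY : closed_cube y0 e `<=` Y).
Hypothesis nlarge : 2 * D ^+ 5 <= n%:R * (2 * e) * rho ^+ 2.

Definition mass_const : R :=
  kernel_floor * (Num.sqrt rho * rho * (2 * e) / (4 * D ^+ 3)) * (2 * e) ^+ 2.

Lemma mass_const_gt0 : 0 < mass_const.
Proof.
rewrite /mass_const /kernel_floor !mulr_gt0 ?exprn_gt0 ?invr_gt0 ?mulr_gt0 ?exprn_gt0 ?expR_gt0 ?sqrtr_gt0//.
Qed.

(** By Tonelli's theorem a cube inside Y is cut into vertical segments, on each of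
which [legendre_line_mass] applies. *)
Lemma section_mass_ge x : X x ->
  ((mass_const * kernel_scale)%:E <= \int[lebesgue3]_y (restricted_kernel (x, y) ^+ 2)%:E)%E.
Proof.
move=> Xx.
pose g (y : R3 R) : R := \1_(closed_cube y0 e) y * (kernel_floor * (zonal_const n *
    (legendre n).[polar_cos (hdist2 (x - y)) (zcoord (x - y))] ^+ 2)).
have kf0 : 0 <= kernel_floor by exact: sqr_ge0.
have z0 : 0 < zonal_const n :> R := zonal_const_gt0 n.
have g0 y : 0 <= g y.
  by rewrite /g; do 3 (apply: mulr_ge0 => //); [exact: ltW|exact: sqr_ge0].
have mg : measurable_fun setT g.
  apply: measurable_funM; first by apply: measurable_indic; exact: measurable_cube.
  apply: measurable_funM => //; apply: measurable_funM => //; apply: measurable_funX.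
  exact: measurableT_comp (measurable_legendre_polar_cos n) (pair1_measurable x).
apply: (@le_trans _ _ (\int[lebesgue3]_y (g y)%:E)%E); last first.
  apply: ge0_le_integral => //.
  - by move=> y _; rewrite lee_fin.
  - exact/measurable_EFinP.
  - apply/measurable_EFinP; apply: measurable_funX.
    exact: measurableT_comp measurable_restricted_kernel (pair1_measurable x).
  - move=> y _; rewrite lee_fin /g indicE; have [|_] := boolP (y \in _); last first.
      by rewrite mul0r sqr_ge0.
    by rewrite inE mul1r => /cubeY Yy; rewrite restricted_kernelE//; exact: Gn0_sqr_ge.
have mgE : measurable_fun setT (EFin \o g) by exact/measurable_EFinP.
have gE0 y : (0 <= (EFin \o g) y)%E by rewrite /= lee_fin.
rewrite (fubini_tonelli1 (EFin \o g))//.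
pose a : R := zcoord y0 - e; pose b : R := zcoord y0 + e.
have eab : b - a = 2 * e by rewrite /a /b; ring.
have ab : a < b by rewrite -subr_gt0 eab mulr_gt0.
pose Q : set (measurableTypeR R * measurableTypeR R) :=
  `[y0.1.1 - e, y0.1.1 + e] `*` `[y0.1.2 - e, y0.1.2 + e].
have mQ : measurable Q by apply: measurableX; exact: measurable_itv.
pose K := kernel_floor * zonal_const n.
have K0 : 0 <= K by rewrite mulr_ge0// ltW.
pose c := K * (Num.sqrt rho * rho * (2 * e) / (4 * D ^+ 3 * legendre_eigenvalue n) * (sonin n).[0]).
have inner u : Q u -> (c%:E <= \int[lebesgue_measure]_s (g (u, s))%:E)%E.
  move=> [Q1 Q2]; pose r := hdist2 (x - (u, y0.2)).
  have inY s : a <= s <= b -> Y (u, s).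
    by move=> sab; apply: cubeY; split; [split|rewrite /= in_itv].
  have rr : rho <= r.
    by apply: gap => //; apply: inY; rewrite /a /b lerBlDr lerDl (ltW e0).
  have r0 : 0 < r by apply: lt_le_trans rr.
  have hD s : a <= s <= b -> r + (x.2 - s) ^+ 2 <= D ^+ 2.
    by move=> /inY Ys; exact: diam Xx Ys.
  have nl : 2 * D ^+ 5 <= n%:R * (b - a) * r ^+ 2.
    apply: (le_trans nlarge); rewrite eab.
    apply: ler_wpM2l; first by rewrite !mulr_ge0// ltW.
    by rewrite lerXn2r ?nnegrE ?(ltW rho0) ?(ltW r0).
  have mass := legendre_line_mass n0 r0 ab D0 hD nl.
  have mp : measurable_fun setT (fun s : measurableTypeR R => (legendre n).[polar_cos r (x.2 - s)] ^+ 2).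
    apply: measurable_funX.
    have := measurableT_comp (measurable_legendre_polar_cos n) (pair1_measurable x).
    by move=> /(fun h => measurableT_comp h (pair1_measurable u)).
  have -> : (\int[lebesgue_measure]_s (g (u, s))%:E =
      K%:E * \int[lebesgue_measure]_(s in `[a, b]) ((legendre n).[polar_cos r (x.2 - s)] ^+ 2)%:E)%E.
    rewrite -ge0_integralZl_EFin//; last 2 first.
    - by move=> s _; rewrite lee_fin sqr_ge0.
    - by apply/measurable_EFinP; exact: measurable_funTS.
    rewrite [RHS]integral_mkcond; apply: eq_integral => s _.
    rewrite patchE /g indicE; case: ifPn => sab.
      have -> : (u, s) \in closed_cube y0 e.
        by rewrite inE; split; [split|move: sab; rewrite inE].
      by rewrite mul1r -EFinM /K; congr (_%:E); rewrite !mulrA.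
    have /negbTE -> : (u, s) \notin closed_cube y0 e.
      by apply: contra sab; rewrite !inE => -[].
    by rewrite mul0r.
  rewrite /c EFinM; apply: lee_wpmul2l; first by rewrite lee_fin.
  apply: le_trans mass; rewrite lee_fin.
  apply: ler_wpM2r; first by rewrite ltW// sonin0_gt0.
  apply: ler_wpM2r; first by rewrite invr_ge0 mulr_ge0 ?(ltW lam0)// mulr_ge0 ?exprn_ge0 ?(ltW D0).
  rewrite eab.
  apply: ler_wpM2r; first by rewrite mulr_ge0// ltW.
  apply: ler_pM => //; rewrite ?sqrtr_ge0 ?(ltW rho0)//.
  by rewrite ler_sqrt ?(ltW r0).
have c0 : 0 <= c.
  rewrite /c mulr_ge0// mulr_ge0 ?(ltW (sonin0_gt0 n0))// divr_ge0//
    !mulr_ge0 ?sqrtr_ge0 ?exprn_ge0 ?(ltW rho0) ?(ltW e0) ?(ltW D0) ?(ltW lam0)//.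
apply: (@le_trans _ _ (\int[lebesgue2]_u (c * \1_Q u)%:E)%E); last first.
  apply: ge0_le_integral => //.
  - by move=> u _; rewrite lee_fin mulr_ge0.
  - by apply/measurable_EFinP; apply: measurable_funM => //; exact: measurable_indic.
  - exact: measurable_fun_fubini_tonelli_F.
  - move=> u _; rewrite indicE; have [|_] := boolP (u \in Q).
      by rewrite inE mulr1; exact: inner.
    by rewrite mulr0; apply: integral_ge0 => s _.
under eq_integral do rewrite EFinM.
rewrite ge0_integralZl_EFin//; last first.
  by apply/measurable_EFinP; exact: measurable_indic.
rewrite integral_indic// setIT /= /lebesgue2 product_measure1E; try exact: measurable_itv.
rewrite /= !lebesgue_measure_itv /= !lte_fin.
have h (p : R) : (p - e < p + e) by rewrite ltrBlDr -addrA ltrDl addr_gt0.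
have E (p : R) : p + e - (p - e) = 2 * e by ring.
rewrite !h -!EFinD !E -!EFinM lee_fin le_eqVlt; apply/orP; left; apply/eqP.
by rewrite /mass_const /kernel_scale /c /K; field; rewrite !gt_eqF.
Qed.
End LowerBound.

End KernelEstimates.

(** * The Gram kernel and the correlation function *)

Lemma enorm_ge_norm (R : realType) (u : R3 R) : `|u| <= enorm u.
Proof.
have h (c : R) : c ^+ 2 <= hdist2 u + zcoord u ^+ 2 -> `|c| <= enorm u.
  by move=> cu; rewrite enormE -sqrtr_sqr ler_sqrt// addr_ge0 ?hdist2_ge0 ?sqr_ge0.
rewrite !prod_normE !ge_max; apply/andP; split; first (apply/andP; split).
- by apply: h; rewrite /hdist2 -addrA lerDl addr_ge0 ?sqr_ge0.
- by apply: h; rewrite /hdist2 addrAC lerDr addr_ge0 ?sqr_ge0.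
- by apply: h; rewrite lerDr hdist2_ge0.
Qed.

Lemma powR_antitone (R : realType) (gamma s t : R) : 0 <= gamma -> 0 < t -> t <= s ->
  s `^ (- gamma) <= t `^ (- gamma).
Proof.
move=> g0 t0 ts; have s0 := lt_le_trans t0 ts.
rewrite !powRN lef_pV2 ?posrE ?powR_gt0//.
by rewrite ge0_ler_powR// nnegrE ltW.
Qed.

(** Below the threshold r the trivial bound on h is used.  Above it the exponent
2 alpha of the decay may be lowered to gamma, since s is bounded away from 0. *)
Lemma sqr_le_powR (R : realType) (alpha gamma C r h s t : R) :
  0 < r -> 0 <= gamma -> gamma <= 2 * alpha -> 0 < t -> t <= s ->
  `|h| <= 1 -> (r <= s -> `|h| <= C * s `^ (- alpha)) ->
  h ^+ 2 <= (C ^+ 2 * r `^ (- (2 * alpha - gamma)) + r `^ gamma) * t `^ (- gamma).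
Proof.
move=> r0 g0 ga t0 ts h1 hC; have s0 := lt_le_trans t0 ts.
have st := powR_antitone g0 t0 ts.
have rg := powR_gt0 gamma r0.
rewrite -(real_normK (num_real h)) mulrDl.
have [rs|sr] := leP r s.
  apply: (@le_trans _ _ (C ^+ 2 * r `^ (- (2 * alpha - gamma)) * t `^ (- gamma))); last first.
    by rewrite lerDl mulr_ge0// powR_ge0.
  apply: (@le_trans _ _ ((C * s `^ (- alpha)) ^+ 2)).
    by rewrite lerXn2r ?nnegrE ?hC//; apply: le_trans (hC rs).
  rewrite exprMn -mulrA ler_wpM2l ?sqr_ge0//.
  have -> : (s `^ (- alpha)) ^+ 2 = s `^ (- (2 * alpha - gamma)) * s `^ (- gamma).
    rewrite -powR_mulrn ?powR_ge0// -powRrM -powRD; first by congr (_ `^ _); ring.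
    by apply/implyP => _; rewrite gt_eqF.
  apply: ler_pM; rewrite ?powR_ge0//.
  by apply: powR_antitone => //; rewrite subr_ge0.
apply: (@le_trans _ _ (r `^ gamma * t `^ (- gamma))); last first.
  by rewrite lerDr mulr_ge0 ?powR_ge0// mulr_ge0 ?sqr_ge0 ?powR_ge0.
apply: (@le_trans _ _ 1); first by rewrite expr_le1.
rewrite powRN -ler_pdivrMr ?invr_gt0 ?powR_gt0// div1r invrK.
by rewrite ge0_ler_powR ?nnegrE ?(ltW t0) ?(ltW r0)// (le_trans ts)// ltW.
Qed.

Section Gram.
Context {R : realType}.
Variables (Omega : set (R3 R)) (sigma : R3 R -> R) (sigma0 sigma1 : R).
Hypotheses (Omega_dom : bounded_convex_domain Omega)
  (sigma_smooth : smooth_on Omega sigma) (sigma0_gt0 : 0 < sigma0)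
  (sigma_bounds : forall x, Omega x -> sigma0 <= sigma x <= sigma1).
Variables (X Y : set (R3 R)).
Hypotheses (cX : compact X) (cY : compact Y) (XOmega : X `<=` Omega) (YOmega : Y `<=` Omega).
Hypothesis iX : X° !=set0.
Variables (rho D : R).
Hypotheses (rho0 : 0 < rho) (D0 : 0 < D)
  (gap : forall x y, X x -> Y y -> rho <= hdist2 (x - y))
  (diam : forall x y, X x -> Y y -> hdist2 (x - y) + zcoord (x - y) ^+ 2 <= D ^+ 2).
Variable n : nat.
Hypothesis n0 : (0 < n)%N.
Implicit Types x y : R3 R.

Local Notation G := (restricted_kernel sigma X Y n).
Local Notation cap := (D ^+ 2 / rho ^+ 3 * kernel_scale n).
Local Notation vX := (fine (lebesgue3 X)).
Local Notation phi := (fun x : R3 R => Num.sqrt cap * \1_X x).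
Local Notation psi := (\1_Y : R3 R -> R).

Let mX : measurable X := compact_measurable3 cX.
Let mY : measurable Y := compact_measurable3 cY.

Lemma volume_gt0 : 0 < vX.
Proof. by rewrite fine_gt0// lebesgue3_gt0//= lebesgue3_compact_fin. Qed.

Lemma cap_gt0 : 0 < cap :> R.
Proof. by rewrite mulr_gt0 ?kernel_scale_gt0// divr_gt0// exprn_gt0. Qed.

Let mG : measurable_fun setT G :=
  measurable_restricted_kernel Omega_dom sigma_smooth cX cY XOmega YOmega n.

Lemma phi_L2 : phi \in Lfun (@lebesgue3 R) 2%:E.
Proof. by apply: indic_L2 => //; exact: lebesgue3_compact_fin. Qed.

Lemma psi_L2 : psi \in Lfun (@lebesgue3 R) 2%:E.
Proof.
have -> : psi = (fun x => 1 * \1_Y x) by apply/funext => x; rewrite mul1r.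
by apply: indic_L2 => //; exact: lebesgue3_compact_fin.
Qed.

Let Gdom x y : `|G (x, y)| <= `|phi x * psi y|.
Proof. exact: (restricted_kernel_dom Omega_dom sigma_smooth sigma0_gt0 sigma_bounds). Qed.

Let colL2 y : (fun x => G (x, y)) \in Lfun (@lebesgue3 R) 2%:E :=
  kernel_section_L2 (measurable_swapk mG) phi_L2 (swapk_dom Gdom) y.

Lemma column_sqr_le y : inner_prod lebesgue3 (fun x => G (x, y)) (fun x => G (x, y)) <= cap * vX.
Proof.
have iX1 := indic_integrable mX (lebesgue3_compact_fin cX).
have -> : cap * vX = \int[lebesgue3]_x (cap * \1_X x).
  rewrite RintegralZl//; congr (_ * fine _).
  by rewrite integral_indic// setIT.
apply: le_Rintegral => //; first exact: L2_mul_integrable.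
  by have := integrableZl measurableT cap iX1; apply: eq_integrable => // x _.
move=> x _; have := Gdom x y; rewrite -(@ler_pXn2r _ 2) ?nnegrE// !real_normK ?num_real//.
rewrite expr2 => /le_trans; apply.
rewrite !exprMn sqr_sqrtr ?(ltW cap_gt0)// -mulrA ler_wpM2l ?(ltW cap_gt0)//.
by rewrite !indicE; case: (x \in X); case: (y \in Y); rewrite ?expr1n ?expr0n ?mulr0 ?mulr1 ?mul0r.
Qed.

Lemma gram_kernel_sqr_le y y' : (gram_kernel lebesgue3 G y y') ^+ 2 <= (cap * vX) ^+ 2.
Proof.
apply: (le_trans (inner_prod_cauchy_schwarz (colL2 y') (colL2 y))).
by rewrite expr2 ler_pM ?inner_prod_ge0 ?column_sqr_le.
Qed.

Lemma columnE y : Y y -> (fun x => G (x, y)) = (Gn0 sigma n ^~ y) \_ X.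
Proof.
move=> Yy; apply/funext => x; rewrite /restricted_kernel !patchE.
have [|xX] := boolP (x \in X); first by rewrite inE => Xx; rewrite mem_set.
by rewrite memNset// => -[/= Xx _]; move: xX; rewrite mem_set.
Qed.

(** If one of the two column norms is 0, the correlation is 0 by the convention on
inverses, but then the Gram kernel vanishes too, by the Cauchy-Schwarz
inequality. *)
Lemma gram_kernel_correlation y y' : Y y -> Y y' ->
  `|gram_kernel lebesgue3 G y y'| <= cap * vX * `|correlation sigma X n y y'|.
Proof.
move=> Yy Yy'; have [c2 c2'] := (colL2 y, colL2 y').
rewrite /correlation !L2norm_L2; try by rewrite -columnE.
rewrite -!columnE//.
have -> : \int[lebesgue3]_(x in X) (Gn0 sigma n x y * Gn0 sigma n x y') = gram_kernel lebesgue3 G y y'.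
  rewrite Rintegral_mkcond /gram_kernel /kernel_op /inner_prod; apply: eq_Rintegral => x _.
  rewrite /swapk /restricted_kernel !patchE /=; have [|xX] := boolP (x \in X).
    by rewrite inE => Xx; rewrite !mem_set// mulrC.
  by rewrite !memNset ?mulr0// => -[/= Xx _]; move: xX; rewrite mem_set.
set w := inner_prod _ _ _; set w' := inner_prod lebesgue3 (fun x => G (x, y')) _.
have cs := inner_prod_cauchy_schwarz c2' c2; rewrite -/w -/w' in cs.
have [w0 w'0] : 0 <= w /\ 0 <= w' by split; exact: inner_prod_ge0.
have ww : Num.sqrt w * Num.sqrt w' <= cap * vX.
  rewrite -sqrtrM// -(@ler_pXn2r _ 2) ?nnegrE ?sqrtr_ge0//; last first.
    by rewrite mulr_ge0 ?ltW ?volume_gt0 ?cap_gt0.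
  rewrite sqr_sqrtr ?mulr_ge0// expr2; apply: ler_pM => //; exact: column_sqr_le.
have [s0|s0] := eqVneq (Num.sqrt w * Num.sqrt w') 0.
  have : gram_kernel lebesgue3 G y y' ^+ 2 <= 0.
    apply: (le_trans cs); rewrite -(sqr_sqrtr w0) -(sqr_sqrtr w'0) -exprMn mulrC s0.
    by rewrite expr0n.
  move=> h; have : gram_kernel lebesgue3 G y y' ^+ 2 == 0 by rewrite eq_le h sqr_ge0.
  by rewrite sqrf_eq0 => /eqP ->; rewrite mulr0 normr0 mulr0.
rewrite normrM normfV; set H := `|gram_kernel _ _ _ _|.
have s1 : 0 < Num.sqrt w * Num.sqrt w' by rewrite lt_def s0 mulr_ge0 ?sqrtr_ge0.
rewrite (gtr0_norm s1) mulrA ler_peMl ?normr_ge0//.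
by rewrite ler_pdivlMr// mul1r.
Qed.

End Gram.

(** * From complex to real separable kernels *)

Section RealPart.
Context d1 d2 (S : measurableType d1) (T : measurableType d2) (R : realType).
Variables (mu : {sigma_finite_measure set S -> \bar R})
          (nu : {sigma_finite_measure set T -> \bar R}).
Variables (X : set S) (Y : set T) (mX : measurable X) (mY : measurable Y).
Variables (N : nat) (f : 'I_N -> S -> R[i]) (g : 'I_N -> T -> R[i]).
Hypotheses (f2 : forall l, in_cL2 mu X (f l)) (g2 : forall l, in_cL2 nu Y (g l)).
Variable G : S * T -> R.
Hypothesis mG : measurable_fun setT (G \_ (X `*` Y)).

Let fr l := (fun x => complex.Re (f l x)) \_ X.
Let fi l := (fun x => complex.Im (f l x)) \_ X.
Let gr l := (fun y => complex.Re (g l y)) \_ Y.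
Let gi l := (fun y => complex.Im (g l y)) \_ Y.

(** The real part of a sum of N complex products, written as a sum of 2 N real
products. *)
Definition real_part_kernel (z : S * T) : R :=
  \sum_(l < N) fr l z.1 * gr l z.2 + \sum_(l < N) - fi l z.1 * gi l z.2.

Let imag_part (z : S * T) : R :=
  \sum_(l < N) (fr l z.1 * gi l z.2 + fi l z.1 * gr l z.2).

Definition real_part_family : seq (T -> R) :=
  [seq gr l | l <- index_enum 'I_N] ++ [seq gi l | l <- index_enum 'I_N].

Lemma size_real_part_family : size real_part_family = (2 * N)%N.
Proof.
rewrite size_cat !size_map -sum1_size sum_nat_const card_ord muln1.
by rewrite mul2n addnn.
Qed.

Lemma real_part_family_L2 : all (fun u => u \in Lfun nu 2%:E) real_part_family.
Proof.
rewrite all_cat; apply/andP; split; rewrite all_map; elim: (index_enum _) => //= l s ->; rewrite andbT.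
  by have [] := in_cL2_ReIm mY (g2 l).
by have [] := in_cL2_ReIm mY (g2 l).
Qed.

Lemma real_part_kernel_span x : in_span real_part_family (fun y => real_part_kernel (x, y)).
Proof.
apply: eq_in_span (in_span_cat
  (in_span_sum (index_enum 'I_N) gr (fun l => fr l x))
  (in_span_sum (index_enum 'I_N) gi (fun l => - fi l x))) => y.
by rewrite /real_part_kernel.
Qed.

Let mfr l : measurable_fun setT (fr l) := L2_measurable (in_cL2_ReIm mX (f2 l)).1.
Let mfi l : measurable_fun setT (fi l) := L2_measurable (in_cL2_ReIm mX (f2 l)).2.
Let mgr l : measurable_fun setT (gr l) := L2_measurable (in_cL2_ReIm mY (g2 l)).1.
Let mgi l : measurable_fun setT (gi l) := L2_measurable (in_cL2_ReIm mY (g2 l)).2.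

Let m1 (h : S -> R) : measurable_fun setT h -> measurable_fun setT (fun z : S * T => h z.1).
Proof. by move=> mh; exact: measurableT_comp mh measurable_fst. Qed.

Let m2 (h : T -> R) : measurable_fun setT h -> measurable_fun setT (fun z : S * T => h z.2).
Proof. by move=> mh; exact: measurableT_comp mh measurable_snd. Qed.

Lemma measurable_real_part_kernel : measurable_fun setT real_part_kernel.
Proof.
apply: measurable_funD; apply: measurable_sum => l; apply: measurable_funM.
- exact: m1 (mfr l).
- exact: m2 (mgr l).
- by apply: measurableT_comp => //; exact: m1 (mfi l).
- exact: m2 (mgi l).
Qed.

Let measurable_imag_part : measurable_fun setT imag_part.
Proof.
apply: measurable_sum => l; apply: measurable_funD; apply: measurable_funM.
- exact: m1 (mfr l).
- exact: m2 (mgi l).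
- exact: m1 (mfi l).
- exact: m2 (mgr l).
Qed.

Let Re_sum (I : Type) (s : seq I) (h : I -> R[i]) :
  complex.Re (\sum_(l <- s) h l) = \sum_(l <- s) complex.Re (h l).
Proof. by elim: s => [|l s IH]; rewrite ?big_nil// !big_cons -IH; case: (h l) (\sum_(_ <- _) _) => [a b] [c d]. Qed.

Let Im_sum (I : Type) (s : seq I) (h : I -> R[i]) :
  complex.Im (\sum_(l <- s) h l) = \sum_(l <- s) complex.Im (h l).
Proof. by elim: s => [|l s IH]; rewrite ?big_nil// !big_cons -IH; case: (h l) (\sum_(_ <- _) _) => [a b] [c d]. Qed.

Lemma normc_error_sqr z :
  ((fun z => Normc.normc ((G z)%:C%C - \sum_(l < N) f l z.1 * g l z.2)) \_ (X `*` Y)) z ^+ 2 =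
  ((G \_ (X `*` Y)) z - real_part_kernel z) ^+ 2 + imag_part z ^+ 2.
Proof.
rewrite normc_restrict_sqr; case: z => x y.
have [xy|xy] := boolP ((x, y) \in X `*` Y); last first.
  rewrite !patchE (negbTE xy).
  have : x \notin X \/ y \notin Y.
    have [Xx|] := boolP (x \in X); last by left.
    have [Yy|] := boolP (y \in Y); last by right.
    by move: xy; rewrite !inE in Xx Yy *; rewrite mem_set.
  move=> h; have -> : real_part_kernel (x, y) = 0.
    rewrite /real_part_kernel !big1 ?addr0// => l _; rewrite /fr /fi /gr /gi !patchE /=;
      by case: h => /negbTE ->; rewrite ?oppr0 ?mul0r ?mulr0.
  have -> : imag_part (x, y) = 0.
    rewrite /imag_part big1// => l _; rewrite /fr /fi /gr /gi !patchE /=.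
    by case: h => /negbTE ->; rewrite ?mul0r ?mulr0 addr0.
  by rewrite subr0.
rewrite !patchE xy; move: xy; rewrite inE => -[/= Xx Yy].
have -> : complex.Re ((G (x, y))%:C%C - \sum_(l < N) f l x * g l y) =
    G (x, y) - real_part_kernel (x, y).
  rewrite /real_part_kernel -big_split /=.
  rewrite (_ : complex.Re (_ - _) = G (x, y) - complex.Re (\sum_(l < N) f l x * g l y)); last first.
    by case: (\sum_(l < N) _).
  rewrite Re_sum; congr (_ - _); apply: eq_bigr => l _.
  rewrite /fr /fi /gr /gi !patchE !mem_set//.
  by case: (f l x) (g l y) => [a b] [c d] /=; rewrite mulNr.
congr (_ + _).
rewrite (_ : complex.Im (_ - _) = - complex.Im (\sum_(l < N) f l x * g l y)); last first.
  by case: (\sum_(l < N) _) => a b /=; rewrite sub0r.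
rewrite sqrrN Im_sum; congr (_ ^+ 2); apply: eq_bigr => l _.
rewrite /fr /fi /gr /gi !patchE !mem_set//.
by case: (f l x) (g l y) => [a b] [c d].
Qed.

Lemma real_part_error_le :
  (\int[mu \x nu]_z (((G \_ (X `*` Y)) z - real_part_kernel z) ^+ 2)%:E <=
  \int[mu \x nu]_z (((fun z => Normc.normc ((G z)%:C%C - (\sum_(l < N) f l z.1 * g l z.2)%R)%R)
     \_ (X `*` Y)) z ^+ 2)%:E)%E.
Proof.
have mK := measurable_real_part_kernel.
under [leRHS]eq_integral do rewrite normc_error_sqr.
apply: ge0_le_integral => //.
- by move=> z _; rewrite lee_fin sqr_ge0.
- by apply/measurable_EFinP; apply: measurable_funX; exact: measurable_funB.
- apply/measurable_EFinP; apply: measurable_funD; apply: measurable_funX => //.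
  exact: measurable_funB.
- by move=> z _; rewrite lee_fin lerDl sqr_ge0.
Qed.

End RealPart.

(** * Rows of the Gram kernel *)

Section GramRow.
Context {R : realType}.
Variables (Omega : set (R3 R)) (sigma : R3 R -> R) (sigma0 sigma1 : R).
Hypotheses (Omega_dom : bounded_convex_domain Omega)
  (sigma_smooth : smooth_on Omega sigma) (sigma0_gt0 : 0 < sigma0)
  (sigma_bounds : forall x, Omega x -> sigma0 <= sigma x <= sigma1).
Variables (X Y : set (R3 R)).
Hypotheses (cX : compact X) (cY : compact Y) (XOmega : X `<=` Omega) (YOmega : Y `<=` Omega).
Hypothesis iX : X° !=set0.
Variables (rho D : R).
Hypotheses (rho0 : 0 < rho) (D0 : 0 < D)
  (gap : forall x y, X x -> Y y -> rho <= hdist2 (x - y))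
  (diam : forall x y, X x -> Y y -> hdist2 (x - y) + zcoord (x - y) ^+ 2 <= D ^+ 2).
Variable n : nat.
Hypothesis n0 : (0 < n)%N.
Variables (L alpha gamma C r : R).
Hypotheses (L0 : 0 < L) (Ldiam : forall y y' : R3 R, Y y -> Y y' -> `|y - y'| <= L)
  (gamma0 : 0 < gamma) (gamma3 : gamma < 3) (gamma_alpha : gamma <= 2 * alpha) (r0 : 0 < r)
  (decay : forall y1 y2, Y y1 -> Y y2 -> r <= n%:R * enorm (y1 - y2) ->
      `|correlation sigma X n y1 y2| <= C * (n%:R * enorm (y1 - y2)) `^ (- alpha)).
Implicit Types y : R3 R.

Local Notation G := (restricted_kernel sigma X Y n).
Local Notation B := (D ^+ 2 / rho ^+ 3 * kernel_scale n * fine (lebesgue3 X)).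

Definition decay_const : R :=
  C ^+ 2 * r `^ (- (2 * alpha - gamma)) + r `^ gamma.

Definition row_const : R :=
  B ^+ 2 * (decay_const * (n%:R * L) `^ (- gamma)).

Lemma decay_const_gt0 : 0 < decay_const.
Proof. by rewrite ltr_wpDl ?powR_gt0// mulr_ge0 ?sqr_ge0 ?powR_ge0. Qed.

Let B0 : 0 < B.
Proof. by rewrite mulr_gt0 ?volume_gt0 ?cap_gt0. Qed.

Let nR0 : 0 < n%:R :> R. Proof. by rewrite ltr0n. Qed.

Lemma row_const_gt0 : 0 < row_const.
Proof. by rewrite /row_const mulr_gt0 ?exprn_gt0// mulr_gt0 ?decay_const_gt0 ?powR_gt0 ?mulr_gt0. Qed.

Lemma gram_kernel_outside y y' : ~ (Y y /\ Y y') -> gram_kernel lebesgue3 G y y' = 0.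
Proof.
move=> nYY; rewrite /gram_kernel /kernel_op /inner_prod /Rintegral integral0_eq// => x _.
rewrite /swapk /restricted_kernel !patchE /=.
have [Yy|Yy] := pselect (Y y).
  by rewrite memNset ?mul0r// => -[/= _ Yy']; apply: nYY.
by rewrite [(x, y) \in _]memNset ?mulr0// => -[].
Qed.

Lemma gram_kernel_sqr_majorant y y' :
  ((gram_kernel lebesgue3 G y y' ^+ 2)%:E <= row_const%:E * dyadic_majorant L gamma (y - y')%R)%E.
Proof.
have W0 := row_const_gt0.
have [[Yy Yy']|nYY] := pselect (Y y /\ Y y'); last first.
  by rewrite gram_kernel_outside// expr0n mule_ge0 ?dyadic_majorant_ge0// lee_fin ltW.
rewrite -lee_pdivrMl//; apply: le_dyadic_majorant => //; first exact: Ldiam.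
move=> yy'; have v0 : 0 < `|y - y'| by rewrite normr_gt0.
pose H := gram_kernel lebesgue3 G y y'.
have HB : `|H| <= B.
  rewrite -(@ler_pXn2r _ 2) ?nnegrE ?(ltW B0)// real_normK ?num_real//.
  exact: (gram_kernel_sqr_le Omega_dom sigma_smooth sigma0_gt0 sigma_bounds).
have t0 : 0 < n%:R * `|y - y'| by rewrite mulr_gt0.
have ts : n%:R * `|y - y'| <= n%:R * enorm (y - y') by rewrite ler_pM2l// enorm_ge_norm.
have h1 : `|H / B| <= 1 by rewrite normrM normfV (gtr0_norm B0) ler_pdivrMr// mul1r.
have hC : r <= n%:R * enorm (y - y') -> `|H / B| <= C * (n%:R * enorm (y - y')) `^ (- alpha).
  move=> rs; rewrite normrM normfV (gtr0_norm B0) ler_pdivrMr// mulrC.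
  have := gram_kernel_correlation Omega_dom sigma_smooth sigma0_gt0 sigma_bounds
    cX cY XOmega YOmega iX rho0 D0 gap diam n0 Yy Yy'.
  move=> /le_trans; apply; rewrite ler_pM2l//; exact: decay.
have := sqr_le_powR r0 (ltW gamma0) gamma_alpha t0 ts h1 hC.
have -> : n%:R * `|y - y'| = (n%:R * L) * (`|y - y'| / L) by field; rewrite gt_eqF.
have nL : 0 <= n%:R * L by rewrite mulr_ge0// ltW.
have vL : 0 <= `|y - y'| / L by rewrite divr_ge0// ltW.
rewrite (powRM _ nL vL) -/decay_const expr_div_n.
rewrite ler_pdivrMr ?exprn_gt0// => hh.
rewrite ler_pdivrMl// /row_const; apply: (le_trans hh).
by rewrite le_eqVlt; apply/orP; left; apply/eqP; ring.
Qed.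

(** Integrate [gram_kernel_sqr_majorant]: the integral of the majorant is
bounded independently of n and y. *)
Lemma gram_row_le y : inner_prod lebesgue3 (gram_kernel lebesgue3 G y) (gram_kernel lebesgue3 G y) <=
  row_const * dyadic_mass L gamma * \1_Y y.
Proof.
have W0 := row_const_gt0.
have mG := measurable_restricted_kernel Omega_dom sigma_smooth cX cY XOmega YOmega n.
have H2 : gram_kernel lebesgue3 G y \in Lfun (@lebesgue3 R) 2%:E.
  exact: gram_kernel_L2 mG (phi_L2 cX _ _ _) (psi_L2 cY)
    (restricted_kernel_dom Omega_dom sigma_smooth sigma0_gt0 sigma_bounds XOmega YOmega
      rho0 D0 gap diam n0) y.
have [Yy|nYy] := pselect (Y y); last first.
  rewrite indicE memNset// mulr0 /inner_prod /Rintegral integral0_eq// => y' _.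
  by rewrite gram_kernel_outside ?mul0r// => -[].
rewrite indicE mem_set// mulr1 -lee_fin.
have -> : ((inner_prod lebesgue3 (gram_kernel lebesgue3 G y) (gram_kernel lebesgue3 G y))%:E =
    \int[lebesgue3]_y' (gram_kernel lebesgue3 G y y' ^+ 2)%:E)%E.
  rewrite /inner_prod /Rintegral fineK; first by apply: eq_integral => y' _; rewrite expr2.
  exact: integrable_fin_num (L2_mul_integrable H2 H2).
have mM := measurable_dyadic_majorant L gamma0 y.
apply: (@le_trans _ _ (\int[lebesgue3]_y' (row_const%:E * dyadic_majorant L gamma (y - y')%R))%E).
  apply: ge0_le_integral => //.
  - by move=> y' _; rewrite lee_fin sqr_ge0.
  - by apply/measurable_EFinP; apply: measurable_funX; exact: L2_measurable H2.
  - exact: emeasurable_funM.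
  - by move=> y' _; exact: gram_kernel_sqr_majorant.
rewrite ge0_integralZl_EFin//; last 2 first.
- by move=> y' _; exact: dyadic_majorant_ge0.
- exact: ltW.
by rewrite [leRHS]EFinM; apply: lee_wpmul2l; [rewrite lee_fin ltW|exact: integral_dyadic_majorant].
Qed.

End GramRow.

(** * Lower bound on the number of separable terms *)

Theorem theorem3p10 (R : realType) (Omega : set (R3 R)) (sigma : R3 R -> R)
    (sigma0 sigma1 : R) (X Y : set (R3 R)) (alpha : R)
    (Omega_dom : bounded_convex_domain Omega)
    (sigma_smooth : smooth_on Omega sigma)
    (sigma0_gt0 : 0 < sigma0)
    (sigma_bounds : forall x, Omega x -> sigma0 <= sigma x <= sigma1)
    (X_dom : convex_compact_domain X) (Y_dom : convex_compact_domain Y)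
    (XOmega : X `<=` Omega) (YOmega : Y `<=` Omega)
    (XY_disj : X `&` Y = set0)
    (XY_xy_disj : (xyproj @` X) `&` (xyproj @` Y) = set0)
    (XY_z_disj : (zcoord @` X) `&` (zcoord @` Y) = set0)
    (alpha_bounds : 1 <= alpha <= 2)
    (decay : correlation_decay sigma X Y alpha)
    (eps delta : R) (eps_gt0 : 0 < eps)
    (* for eps >= 1 the estimate holds with N = 0 *)
    (eps_lt1 : eps < 1)
    (delta_bounds : 0 < delta < 1) :
  exists c : R, 0 < c /\
    exists n0 : nat, forall n : nat, (n0 <= n)%N ->
      forall (N : nat) (f g : 'I_N -> R3 R -> R[i]),
        (forall l, in_cL2 lebesgue3 X (f l)) ->
        (forall l, in_cL2 lebesgue3 Y (g l)) ->
        separable_approx sigma X Y n eps f g ->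
        c * rank_rate alpha delta n <= N%:R.
Proof.
have [cX iX _] := X_dom; have [cY iY _] := Y_dom.
have [C [r [C0 r0 dec]]] := decay.
have [mX mY] := (compact_measurable3 cX, compact_measurable3 cY).
have [rho rho0 gap] := horizontal_gap cX cY XY_xy_disj.
have [D D0 diam] := diameter_bound cX cY.
have [y0 [e [e0 cubeY]]] := interior_cube iY.
have [L L0 Ldiam] : exists2 L : R, 0 < L & forall y y' : R3 R, Y y -> Y y' -> `|y - y'| <= L.
  have [M [_ hM]] := compact_bounded cY.
  pose M1 := `|M| + 1; have M10 : 0 < M1 by rewrite ltr_wpDl.
  have bnd y : Y y -> `|y| <= M1.
    by move=> Yy; apply: (hM M1) => //; rewrite (le_lt_trans (ler_norm M))// ltrDl.
  exists (M1 + M1); first by rewrite addr_gt0.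
  by move=> y y' Yy Yy'; apply: (le_trans (ler_normB _ _)); rewrite lerD ?bnd.
(* In both cases the rate is n ^ gamma with gamma < 3. *)
pose gamma : R := if 3 / 2 <= alpha then 3 - 3 * delta else 2 * alpha.
have [/andP[a1 a2] /andP[d0 d1]] := (alpha_bounds, delta_bounds).
have [gamma0 gamma3 gamma_alpha] : [/\ 0 < gamma, gamma < 3 & gamma <= 2 * alpha].
  by rewrite /gamma; case: (leP (3 / 2) alpha) => h; split; lra.
have rateE n : rank_rate alpha delta n = n%:R `^ gamma.
  by rewrite /rank_rate /gamma; case: ifP.
pose vX := fine (lebesgue3 X); pose vY := fine (lebesgue3 Y).
have vX0 : 0 < vX := volume_gt0 cX iX.
have vY0 : 0 < vY := volume_gt0 cY iY.
pose c1 := mass_const sigma1 rho D e; have c10 : 0 < c1 := mass_const_gt0 sigma1 rho0 D0 e0.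
pose C1 := D ^+ 2 / rho ^+ 3; have C10 : 0 < C1 by rewrite divr_gt0 ?exprn_gt0.
pose C2 := decay_const alpha gamma C r.
have C20 : 0 < C2 := decay_const_gt0 alpha gamma C r0.
pose mass := dyadic_mass L gamma.
have mass0 : 0 < mass := dyadic_mass_gt0 L0 gamma0 gamma3.
(* q n^(- gamma) bounds the squared Hilbert-Schmidt norm of the Gram kernel,
   in units of (kernel_scale n * vX)^2. *)
pose q := C1 ^+ 2 * C2 * L `^ (- gamma) * mass * vY.
have q0 : 0 < q.
  by rewrite /q mulr_gt0// mulr_gt0// mulr_gt0 ?powR_gt0// mulr_gt0// exprn_gt0.
have e21 : 0 < 1 - eps ^+ 2.
  by rewrite subr_gt0 expr_lt1 ?ltW.
pose c := (1 - eps ^+ 2) ^+ 2 * c1 ^+ 2 / (2 * q).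
have c0 : 0 < c.
  by apply: divr_gt0; apply: mulr_gt0 => //; exact: exprn_gt0.
exists c; split => //.
(* From n1 + 1 on, the lower bound on the mass of P_n holds on Y. *)
pose n1 := Num.truncn (2 * D ^+ 5 / (2 * e * rho ^+ 2)).
exists n1.+1 => n n1n N f g f2 g2 approx; rewrite rateE.
have n0 : (0 < n)%N by apply: leq_trans n1n.
have nR0 : 0 < n%:R :> R by rewrite ltr0n.
have nlarge : 2 * D ^+ 5 <= n%:R * (2 * e) * rho ^+ 2.
  rewrite -mulrA -ler_pdivrMr ?mulr_gt0 ?exprn_gt0//.
  by apply: (le_trans (ltW (truncnS_gt _))); rewrite ler_nat.
pose A : R := kernel_scale n; have A0 : 0 < A by exact: kernel_scale_gt0.
pose G := restricted_kernel sigma X Y n.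
have mG : measurable_fun setT G := measurable_restricted_kernel Omega_dom sigma_smooth cX cY XOmega YOmega n.
have phi2 := phi_L2 cX rho D n.
have psi2 := psi_L2 cY.
have Gdom := restricted_kernel_dom Omega_dom sigma_smooth sigma0_gt0 sigma_bounds XOmega YOmega rho0 D0 gap diam n0.
pose tau := \int[lebesgue3]_x inner_prod lebesgue3 (fun y => G (x, y)) (fun y => G (x, y)).
have tauE := kernel_sqr_integral mG phi2 psi2 Gdom.
have tau_ge : c1 * A * vX <= tau.
  have iX1 := indic_integrable mX (lebesgue3_compact_fin cX).
  have -> : c1 * A * vX = \int[lebesgue3]_x (c1 * A * \1_X x).
    by rewrite RintegralZl//; congr (_ * fine _); rewrite integral_indic// setIT.
  apply: le_Rintegral => //.
  - by have := integrableZl measurableT (c1 * A) iX1; apply: eq_integrable => // x _.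
  - exact: kernel_sqr_integrable mG phi2 psi2 Gdom.
  - move=> x _; rewrite indicE; have [|_] := boolP (x \in X); last by rewrite mulr0 inner_prod_ge0.
    rewrite inE mulr1 => Xx.
    have sG := kernel_section_L2 mG psi2 Gdom x.
    have := section_mass_ge Omega_dom sigma_smooth sigma0_gt0 sigma_bounds cX cY XOmega YOmega
      rho0 D0 gap diam n0 e0 cubeY nlarge Xx.
    rewrite -lee_fin => /le_trans; apply.
    rewrite /inner_prod /Rintegral fineK; last exact: integrable_fin_num (L2_mul_integrable sG sG).
    by rewrite le_eqVlt; apply/orP; left; apply/eqP; apply: eq_integral => y _; rewrite expr2.
have tau0 : 0 < tau by apply: lt_le_trans tau_ge; rewrite mulr_gt0// mulr_gt0.
pose W := row_const X rho D n L alpha gamma C r.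
pose chi (y : R3 R) : R := W * mass * \1_Y y.
have iY1 := indic_integrable mY (lebesgue3_compact_fin cY).
have ichi : lebesgue3.-integrable setT (EFin \o chi).
  by have := integrableZl measurableT (W * mass) iY1; apply: eq_integrable => // x _.
have chiE : \int[lebesgue3]_y chi y = W * mass * vY.
  by rewrite /chi RintegralZl//; congr (_ * fine _); rewrite integral_indic// setIT.
have rows := gram_row_le Omega_dom sigma_smooth sigma0_gt0 sigma_bounds cX cY XOmega YOmega iX
  rho0 D0 gap diam n0 L0 Ldiam gamma0 gamma3 gamma_alpha r0 (dec n).
pose K := real_part_kernel X Y f g.
have mK : measurable_fun setT K.
  exact: (measurable_real_part_kernel (mu := lebesgue3) (nu := lebesgue3) mX mY f2 g2).
have KE : (\int[lebesgue3 \x lebesgue3]_z ((G z - K z) ^+ 2)%:E <= (eps ^+ 2 * tau)%:E)%E.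
  apply: (le_trans (real_part_error_le (mu := lebesgue3) (nu := lebesgue3) mX mY f2 g2 mG)).
  apply: (le_trans (L2norm_le_sqr (ltW eps_gt0) approx)).
  by rewrite [leRHS]EFinM /tau -tauE.
have Etau : eps ^+ 2 * tau <= tau by rewrite ler_piMl ?(ltW tau0)// -subr_ge0 ltW.
have := finite_rank_bound mG phi2 psi2 Gdom ichi rows mK (real_part_family_L2 mY g2)
  (real_part_kernel_span X Y f g) KE Etau.
rewrite size_real_part_family chiE -/tau => bound.
(* The scale A of the kernel and the volume of X cancel here. *)
have main : (1 - eps ^+ 2) ^+ 2 * c1 ^+ 2 <= 2 * N%:R * (q * n%:R `^ (- gamma)).
  have AV : 0 < (A * vX) ^+ 2 by apply: exprn_gt0; exact: mulr_gt0.
  rewrite -(ler_pM2r AV).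
  apply: (@le_trans _ _ ((tau - eps ^+ 2 * tau) ^+ 2)).
    have -> : tau - eps ^+ 2 * tau = (1 - eps ^+ 2) * tau by ring.
    have lhs0 : 0 <= (1 - eps ^+ 2) * c1 * (A * vX).
      by apply: mulr_ge0; apply: mulr_ge0; exact: ltW.
    have rhs0 := mulr_ge0 (ltW e21) (ltW tau0).
    rewrite -!exprMn lerXn2r ?nnegrE//.
    by rewrite -mulrA ler_pM2l// mulrA.
  apply: (le_trans bound); rewrite natrM /W /row_const /q -/C1 -/A -/vX -/C2.
  by rewrite powRM ?(ltW L0)// le_eqVlt; apply/orP; left; apply/eqP; ring.
have q20 : 0 < 2 * q by apply: mulr_gt0.
have ng := powR_gt0 gamma nR0.
rewrite /c mulrAC (ler_pdivrMr _ _ q20) -(ler_pdivlMr _ _ ng).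
apply: (le_trans main); rewrite powRN.
by rewrite le_eqVlt; apply/orP; left; apply/eqP; ring.
Qed.
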